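(* Let $d$ be a graphical degree function. If the realization graph $G(d)$ is triangle-free, then $G(d)$ is maximally Hamiltonian. (A triangle-free realization graph is bipartite, so the assertion is that $G(d)$ is Hamilton-laceable, the one-vertex graph being maximally Hamiltonian by convention.)
   Context: All graphs are finite and simple. A degree function on a finite set $V$ with $|V|=n$ is a map $d:V\to\{0,1,\dots,n-1\}$; it is graphical if some simple graph on vertex set $V$ has $\deg(u)=d(u)$ for all $u\in V$. Such a (labeled) graph is a realization of $d$. The realization graph $G(d)$ has as vertices all realizations of $d$; two realizations are adjacent when the symmetric difference of their edge sets has exactly four elements (equivalently, they differ by a single 2-switch). A graph is Hamilton-connected if every two distinct vertices are the endpoints of a Hamilton path. A bipartite graph with a proper 2-coloring using both colors is Hamilton-laceable if every two vertices of opposite colors are the endpoints of a Hamilton path. A graph is maximally Hamiltonian if it is bipartite and Hamilton-laceable for a proper 2-coloring with both color classes nonempty, or it is non-bipartite and Hamilton-connected; by convention $K_1$ (and $K_2$) are maximally Hamiltonian. That triangle-free realization graphs are bipartite is a known result of Barrus. *)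

(* Defs.v *)
From HB Require Import structures.
From mathcomp Require Import all_boot.

Set Implicit Arguments.
Unset Strict Implicit.
Unset Printing Implicit Defensive.

(* A graph on a finType T is given by its adjacency relation e : rel T; the
   notions below are meant for symmetric irreflexive e (see realization_adj_sym
   and realization_adj_irrefl). *)
Section Graphs.
Variables (T : finType) (e : rel T).

Definition triangle_free : Prop :=
  forall x y z : T, ~ [/\ e x y, e y z & e x z].

(* x :: p is the vertex sequence of the Hamilton path. *)
Definition hamilton_path_between (x y : T) : Prop :=
  exists p : seq T,
    [/\ path e x p, last x p = y, uniq (x :: p) & forall z : T, z \in x :: p].

Definition hamilton_connected : Prop :=
  forall x y : T, x != y -> hamilton_path_between x y.

Definition proper_2coloring (c : T -> bool) : Prop :=
  forall x y : T, e x y -> c x != c y.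

Definition bipartite : Prop := exists c : T -> bool, proper_2coloring c.

Definition uses_both_colors (c : T -> bool) : Prop :=
  (exists x : T, c x) /\ (exists y : T, ~~ c y).

Definition hamilton_laceable (c : T -> bool) : Prop :=
  forall x y : T, c x != c y -> hamilton_path_between x y.

Definition is_complete_graph (n : nat) : Prop :=
  #|T| = n /\ forall x y : T, x != y -> e x y.

Definition maximally_hamiltonian : Prop :=
  [\/ is_complete_graph 1 \/ is_complete_graph 2,
      exists c : T -> bool,
        [/\ proper_2coloring c, uses_both_colors c & hamilton_laceable c]
    | ~ bipartite /\ hamilton_connected].

End Graphs.

(* A simple graph on V is given by its set E of edges, which are 2-element
   subsets of V. A degree function takes values in 'I_#|V|, that is, in
   {0, ..., n-1} with n the number of vertices. *)
Section RealizationGraph.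
Variable V : finType.

Definition is_edge_set (E : {set {set V}}) : bool :=
  [forall a in E, #|a| == 2].

Definition degree (E : {set {set V}}) (v : V) : nat := #|[set a in E | v \in a]|.

Definition symdiff (E F : {set {set V}}) : {set {set V}} :=
  (E :\: F) :|: (F :\: E).

Variable d : V -> 'I_#|V|.

Definition is_realization (E : {set {set V}}) : bool :=
  is_edge_set E && [forall v, degree E v == d v :> nat].

Definition graphical : Prop := exists E : {set {set V}}, is_realization E.

Definition realization : Type := {E : {set {set V}} | is_realization E}.
HB.instance Definition _ := SubFinite.on realization.

Definition realization_adj : rel realization :=
  fun R S => #|symdiff (val R) (val S)| == 4.

Lemma realization_adj_sym : symmetric realization_adj.
Proof. by move=> R S; rewrite /realization_adj /symdiff setUC. Qed.

Lemma realization_adj_irrefl : irreflexive realization_adj.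
Proof. by move=> R; rewrite /realization_adj /symdiff setDv setU0 cards0. Qed.

End RealizationGraph.

Arguments realization_adj {V} d R S.

(* Main.v *)
Require Import Defs.
From mathcomp Require Import all_boot perm.

(** A 2-switch removes two disjoint edges ux, vy of a realization S and adds the
    nonedges uy, vx. Call x a private neighbour of u with respect to v, and y a
    private neighbour of v with respect to u.

    Triangle-freeness is very restrictive. If u had another private neighbour
    x' with respect to v, then switching with x and switching with x' would give
    two adjacent neighbours of S, so private neighbours in a switch are unique
    ([private_unique]). If u, v, x, y induced 2K_2 or C_4, the three perfect
    matchings of these vertices would give a triangle, so they induce a path
    ([alternating_P4]). Consequently u and v have the same degree, and the switch
    is the same thing as exchanging the names u and v: it acts on S as the
    transposition (u v) ([adj_switch_tperm]).

    Bipartiteness. In S every pair {u, v} that can be switched has a unique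
    opposite pair {x, y}, and exactly one of the two pairs is an edge. Colour S
    by the parity of the number of edges uv of this kind whose order agrees with
    the order of the opposite pair; for realizations that amount to a
    permutation this is the sign. Under the transposition tau of a switch this
    number changes, modulo 2, by the number of pairs, edges or not, that tau
    inverts; the pairs that can be switched are all the pairs in certain classes,
    so tau inverts an odd number of them and the colour changes
    ([colour_switch]).

    Laceability. By induction on the number of vertices outside F, the set of
    realizations in which each vertex of F has a prescribed neighbourhood is a
    single point or is laceable with both colours present
    ([agreeing_laceable]). For u outside F, split this set into cells according to
    the neighbourhood of u. Two cells whose labels N, N' differ by one exchange
    x, y are joined: in each realization of the first cell, the switch on x and y
    leads to the second. So it suffices that any two labels are joined by a
    spanning path of labels; then spanning paths of the cells can be
    concatenated ([glue_cells]). If all labels differ by at most one exchange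
    this is clear. Otherwise the degree class of u has five vertices, and labels
    restrict to it as 2-subsets of the four vertices other than u (the case where
    the class induces a 5-cycle); each label then fails to be joined to at most one
    other, its complement, and there are at least five labels
    ([labels_nearly_complete], [far_labels_many]), which again gives spanning
    paths ([nearly_complete_spanning_path]). *)

Set Implicit Arguments.
Unset Strict Implicit.
Unset Printing Implicit Defensive.

(** * Spanning paths in nearly complete graphs *)

Section SpanningPaths.
Variables (T : finType) (e : rel T).

Definition spanning_path (X : {set T}) (a b : T) : Prop :=
  exists p : seq T, [/\ path e a p, last a p = b, uniq (a :: p) & a :: p =i X].

Lemma spanning_path_setT a b :
  spanning_path [set: T] a b -> hamilton_path_between e a b.
Proof.
case=> p [pth lst unq cov]; exists p; split=> // z.
by rewrite cov inE.
Qed.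

Lemma spanning_path_cons (X : {set T}) a a' b :
    a \in X -> e a a' -> spanning_path (X :\ a) a' b -> spanning_path X a b.
Proof.
move=> aX eaa' [p [pth lst unq cov]]; exists (a' :: p); split => //=.
- by rewrite eaa' pth.
- by rewrite cov !inE eqxx.
- move=> z; rewrite inE cov !inE.
  by case: (eqVneq z a) => [->|].
Qed.

End SpanningPaths.

Section NearlyComplete.
Variables (I : finType) (r : rel I).
Hypothesis r_sym : symmetric r.

(** The complement of the graph on L is a matching. *)
Definition nearly_complete (L : {set I}) : Prop :=
  forall i j k : I, i \in L -> j \in L -> k \in L ->
  i != j -> i != k -> ~~ r i j -> ~~ r i k -> j = k.

Definition complete_on (L : {set I}) : Prop :=
  {in L &, forall i j, i != j -> r i j}.

(** Five vertices are the least number that works: on the 4-cycle K_{2,2}, two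
    opposite vertices are not the ends of a Hamilton path. *)
Lemma nearly_complete5 (L : {set I}) : #|L| = 5 -> nearly_complete L ->
  {in L &, forall i j, i != j -> spanning_path r L i j}.
Proof.
move=> L5 ncL a b aL bL ab.
have : #|L :\ a :\ b| = 3.
  move: L5; rewrite (cardsD1 a) aL (cardsD1 b) !inE bL eq_sym ab /=.
  by case.
rewrite cardE; move: (enum_uniq (L :\ a :\ b)) (mem_enum (L :\ a :\ b)).
case: (enum _) => [|x [|y [|z []]]] //= uxyz memL _.
have [xy xz yz] : [/\ x != y, x != z & y != z].
  by move: uxyz; rewrite !inE negb_or andbT => /andP[/andP[-> ->] ->].
have mem3 w : (w \in [:: x; y; z]) = [&& w != b, w != a & w \in L].
  by rewrite memL !inE.
have /and3P[xb xa xL] : [&& x != b, x != a & x \in L].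
  by rewrite -mem3 !inE eqxx.
have /and3P[yb ya yL] : [&& y != b, y != a & y \in L].
  by rewrite -mem3 !inE eqxx orbT.
have /and3P[zb za zL] : [&& z != b, z != a & z \in L].
  by rewrite -mem3 !inE eqxx !orbT.
have two i j k : i \in L -> j \in L -> k \in L ->
    i != j -> i != k -> j != k -> r i j || r i k.
  move=> iL jL kL ij ik; apply: contraNT; rewrite negb_or => /andP[nij nik].
  exact/eqP/(ncL i j k).
have path3 u v w : perm_eq [:: u; v; w] [:: x; y; z] ->
    [&& r a u, r u v, r v w & r w b] -> spanning_path r L a b.
  move=> uvw /and4P[au uv vw wb]; exists [:: u; v; w; b]; split.
  - by rewrite /= au uv vw wb.
  - by [].
  - have /perm_uniq-> : perm_eq (a :: [:: u; v; w] ++ [:: b])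
                                (a :: [:: x; y; z] ++ [:: b]).
      by rewrite perm_cons perm_cat2r.
    rewrite /= !inE !negb_or (eq_sym a x) (eq_sym a y) (eq_sym a z).
    by rewrite ab xa ya za xy xz xb yz yb zb.
  - move=> t; have := perm_mem uvw t; rewrite mem3 !inE.
    case: (eqVneq t a) => [->|_ /=]; first by rewrite aL.
    case: (eqVneq t b) => [->|_ /=]; first by rewrite bL !orbT.
    by move=> <-; rewrite orbF.
(* One of the six orders of the inner vertices works; this is a tautology in the
   nine adjacencies once no vertex misses two others. *)
suff : [|| [&& r a x, r x y, r y z & r z b], [&& r a x, r x z, r z y & r y b],
           [&& r a y, r y x, r x z & r z b], [&& r a y, r y z, r z x & r x b],
           [&& r a z, r z x, r x y & r y b] | [&& r a z, r z y, r y x & r x b]].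
  by case/or4P=> [||| /or3P[]]; apply: path3; apply/seq.permP=> P /=;
    case: (P x); case: (P y); case: (P z).
have : [&& r a x || r a y, r a x || r a z, r a y || r a z, r b x || r b y, r
    b x || r b z, r b y || r b z, r x y || r x z, r y x || r y z, r z x || r
    z y, r x a || r x y, r x a || r x z, r x b || r x y, r x b || r x z, r y
    a || r y x, r y a || r y z, r y b || r y x, r y b || r y z, r z a || r z
    x, r z a || r z y, r z b || r z x & r z b || r z y].
  by rewrite !two // eq_sym.
rewrite !(r_sym b) !(r_sym x a) !(r_sym y a) !(r_sym z a) !(r_sym y x).
rewrite !(r_sym z x) !(r_sym z y).
case: (r a x); case: (r a y); case: (r a z); case: (r x b); case: (r y b);
  case: (r z b); case: (r x y); case: (r x z); case: (r y z) => //=.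
Qed.

(** Step from a to any neighbour other than b and delete a; the property is
    inherited until five vertices, or an edge, are left. *)
Lemma nearly_complete_spanning_path (L : {set I}) :
    nearly_complete L -> complete_on L \/ 5 <= #|L| ->
  {in L &, forall i j, i != j -> spanning_path r L i j}.
Proof.
have [n] := ubnP #|L|; elim: n L => // n IHn L; rewrite ltnS => leLn ncL big.
move=> a b aL bL ab.
have bLa : b \in L :\ a by rewrite !inE eq_sym ab.
have [smallL|] := boolP (L :\ a :\ b == set0).
  have Lab : L = [set a; b].
    by rewrite -(setD1K aL) -(setD1K bLa) (eqP smallL) setU0.
  have rab : r a b.
    case: big => [cL|]; first exact: cL.
    by rewrite Lab cards2; case: (a != b).
  exists [:: b]; split => //=; first by rewrite rab.
    by rewrite inE ab.
  by move=> z; rewrite Lab !inE.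
case: big => [cL|]; last rewrite leq_eqVlt => /orP[/eqP L5|gtL5].
- case/set0Pn=> a' /setD1P[a'b a'La]; have /setD1P[a'a a'L] := a'La.
  apply: (@spanning_path_cons _ _ _ a a') => //; first by rewrite cL // eq_sym.
  apply: IHn => //.
  - by apply: leq_trans leLn; rewrite [in X in _ < X](cardsD1 a) aL.
  - by move=> i j k /setD1P[_ iL] /setD1P[_ jL] /setD1P[_ kL]; apply: ncL.
  - by left=> i j /setD1P[_ iL] /setD1P[_ jL]; apply: cL.
- by move=> _; apply: nearly_complete5.
- move=> _.
  have : 1 < #|L :\ a :\ b|.
    move: gtL5; rewrite (cardsD1 a) aL (cardsD1 b) bLa.
    by case: #|_| => [|[]].
  case/card_gt1P=> x [y [/setD1P[xb xLa] /setD1P[yb yLa] xy]].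
  have [a' [a'La a'b raa']] : exists a', [/\ a' \in L :\ a, a' != b & r a a'].
    have [rax|nax] := boolP (r a x); first by exists x.
    have [ray|nay] := boolP (r a y); first by exists y.
    case/setD1P: xLa => xa xL; case/setD1P: yLa => ya yL.
    by rewrite (ncL a x y) ?eqxx // eq_sym in xy.
  have /setD1P[a'a a'L] := a'La.
  apply: (@spanning_path_cons _ _ _ a a') => //; apply: IHn => //.
  - by apply: leq_trans leLn; rewrite [in X in _ < X](cardsD1 a) aL.
  - by move=> i j k /setD1P[_ iL] /setD1P[_ jL] /setD1P[_ kL]; apply: ncL.
  - by right; move: gtL5; rewrite (cardsD1 a) aL.
Qed.

End NearlyComplete.
(** * Gluing laceable cells *)

Section Gluing.
Variables (T I : finType) (e : rel T) (c : T -> bool) (g : T -> I) (r : rel I).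
Hypotheses (e_sym : symmetric e) (c_proper : proper_2coloring e c).

Definition laceable_on (X : {set T}) : Prop :=
  {in X &, forall a b, c a != c b -> spanning_path e X a b}.

Definition point_or_laceable (X : {set T}) : Prop :=
  (exists s, X = [set s]) \/
  (exists s t, [/\ s \in X, t \in X & c s != c t]) /\ laceable_on X.

Variable X : {set T}.

Definition cell (i : I) : {set T} := [set s in X | g s == i].

Hypothesis r_sym : symmetric r.
Hypothesis cell_step : forall s j, s \in X -> j \in g @: X -> r (g s) j ->
  exists t, [/\ t \in X, g t = j & e s t].
Hypothesis labels_connected :
  {in g @: X &, forall i j, i != j -> spanning_path r (g @: X) i j}.
Hypothesis cells_good : {in X, forall s, point_or_laceable (cell (g s))}.

Lemma mem_cell s : s \in X -> s \in cell (g s).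
Proof. by move=> sX; rewrite inE sX eqxx. Qed.

Lemma edge_colors s t u : e s t -> c s != c u -> c t = c u.
Proof. by move=> /c_proper; case: (c s); case: (c t); case: (c u). Qed.

(** All points of the second cell are adjacent to s, so they have one colour. *)
Lemma point_cell_step s t : s \in X -> t \in X -> r (g s) (g t) ->
  cell (g s) = [set s] -> cell (g t) = [set t].
Proof.
move=> sX tX rst cs.
have adj_s u : u \in cell (g t) -> e u s.
  rewrite inE => /andP[uX /eqP gu].
  have [|v [vX gv euv]] := cell_step uX (imset_f g sX); first by rewrite gu r_sym.
  have : v \in cell (g s) by rewrite inE vX gv eqxx.
  by rewrite cs inE => /eqP <-.
have tC := mem_cell tX.
case: (cells_good tX) => [[u cu]|[[u [v [uC vC cuv]]] _]].
  by move: tC; rewrite cu inE => /eqP->.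
by move: cuv; have := c_proper (adj_s u uC); have := c_proper (adj_s v vC);
  case: (c u); case: (c v); case: (c s).
Qed.

(** A one-point cell has no second colour to cross to; here the label path is
    lifted step by step instead. *)
Lemma point_cells_path i q : path r i q -> {subset i :: q <= g @: X} ->
  forall s, s \in X -> g s = i -> cell i = [set s] ->
  exists p, [/\ path e s p, [seq g u | u <- p] = q,
    {subset p <= X} & {in p, forall u, cell (g u) = [set u]}].
Proof.
elim: q i => [|j q IHq] i /=; first by move=> _ _ s _ _ _; exists [::].
move=> /andP[rij pthq] sub s sX gs cs; rewrite -gs in rij cs.
have jL : j \in g @: X by apply: sub; rewrite !inE eqxx orbT.
have [t [tX gt est]] := cell_step sX jL rij; rewrite -gt in rij.
have ct := point_cell_step sX tX rij cs.
have [||p [pth gp pX pc]] := IHq j pthq _ t tX gt.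
- by move=> k kq; apply: sub; rewrite inE kq orbT.
- by rewrite -gt.
exists (t :: p); split => //=; first by rewrite est pth.
- by rewrite gt gp.
- by move=> u; rewrite inE => /predU1P[->|/pX].
- by move=> u; rewrite inE => /predU1P[->|/pc].
Qed.

(** Cross each cell from its entry point to a point of the other colour and step
    to the next cell: every cell is then entered at a point of the colour of a, so
    the last one can be crossed to b, whose colour is the other one. *)
Lemma lift_path_through_cells i q : path r i q -> uniq (i :: q) ->
    {subset i :: q <= g @: X} ->
    {in X, forall s, laceable_on (cell (g s)) /\
       exists s' t', [/\ s' \in cell (g s), t' \in cell (g s) & c s' != c t']} ->
  forall a b, a \in X -> b \in X -> g a = i -> g b = last i q -> c a != c b ->
  exists p, [/\ path e a p, last a p = b, uniq (a :: p)
    & forall s, (s \in a :: p) = (s \in X) && (g s \in i :: q)].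
Proof.
move=> + + + lac; elim: q i => [|j q IHq] i /=.
  move=> _ _ _ a b aX bX ga gb cab; rewrite -gb in ga *.
  have [|p [pth lst unq cov]] := (lac a aX).1 a b (mem_cell aX) _ cab.
    by rewrite ga mem_cell.
  exists p; split=> // s; rewrite cov !inE; congr (_ && _).
  by rewrite ga.
move=> /andP[rij pthq] /andP[inotin uniqq] sub a b aX bX ga gb cab.
have jL : j \in g @: X by apply: sub; rewrite !inE eqxx orbT.
have [a' [aC' caa']] : exists a', a' \in cell (g a) /\ c a != c a'.
  have [_ [s' [t' [sC tC cst]]]] := lac a aX.
  have [cas|cas] := boolP (c a == c s'); last by exists s'.
  by exists t'; rewrite (eqP cas).
have [p1 [pth1 lst1 unq1 cov1]] := (lac a aX).1 a a' (mem_cell aX) aC' caa'.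
have [aX' ga'] : a' \in X /\ g a' = i by move: aC'; rewrite inE ga => /andP[? /eqP].
have [|t [tX gt eat]] := cell_step aX' jL; first by rewrite ga'.
have ct : c t = c a by apply: edge_colors eat _; rewrite eq_sym.
have [||p2 [pth2 lst2 unq2 cov2]] := IHq j pthq uniqq _ t b tX bX gt gb.
- by move=> k kq; apply: sub; rewrite inE kq orbT.
- by rewrite ct.
exists (p1 ++ t :: p2); split.
- by rewrite cat_path /= lst1 eat pth1 pth2.
- by rewrite last_cat /= lst2.
- change (uniq ((a :: p1) ++ t :: p2)); rewrite cat_uniq unq1 unq2 andbT.
  apply/hasPn=> s.
  rewrite cov2 cov1 => /andP[sX gs]; rewrite inE sX ga /=.
  by apply: contra inotin => /eqP <-.
- move=> s; rewrite -[a :: _ ++ _]/((a :: p1) ++ t :: p2) mem_cat cov1 cov2 inE ga inE.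
  by rewrite -andb_orr.
Qed.

(** For ends in different cells, lift a spanning path of labels. For ends a, b in
    the same cell, take a spanning path a, a', ..., b of that cell and replace its
    first edge by a detour through all other cells. *)
Lemma glue_cells : X != set0 -> point_or_laceable X.
Proof.
case/set0Pn=> s0 s0X.
have [sameL|] := boolP [forall s in X, g s == g s0].
  have -> : X = cell (g s0); last exact: cells_good.
  apply/setP=> s; rewrite inE; case sX: (s \in X) => //=.
  by rewrite (forall_inP sameL).
case/forall_inPn=> s1 s1X gs10.
(* A spanning path of labels from a label to one of its neighbours closes up to
   the cycle that the detour follows. *)
have next s : s \in X -> exists t q, [/\ t \in X, r (g s) (g t), e s t &
    [/\ path r (g s) q, last (g s) q = g t, uniq (g s :: q)
      & g s :: q =i g @: X]].
  move=> sX.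
  have [i iL igs] : exists2 i, i \in g @: X & g s != i.
    have [->|ns] := eqVneq (g s) (g s0); last by exists (g s0); rewrite ?imset_f.
    by exists (g s1); rewrite ?imset_f // eq_sym.
  have [q [pth lst unq cov]] := labels_connected (imset_f g sX) iL igs.
  case: q pth lst unq cov => [_ /eqP|j q]; first by rewrite (negPf igs).
  move=> /= /andP[rsj _] _ /andP[jn _] cov.
  have jL : j \in g @: X by rewrite -cov !inE eqxx orbT.
  have sj : g s != j by apply: contraNneq jn => ->; rewrite inE eqxx.
  have [t [tX gt est]] := cell_step sX jL rsj.
  have [q' spq'] := labels_connected (imset_f g sX) jL sj.
  by exists t, q'; rewrite gt.
right; split.
  have [t [q [tX _ est _]]] := next s0 s0X.
  by exists s0, t; split=> //; apply: c_proper.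
have [/exists_inP[s sX /eqP cs]|nopoint] :=
  boolP [exists s in X, cell (g s) == [set s]].
  have points t : t \in X -> cell (g t) = [set t].
    move=> tX; have [gts|] := eqVneq (g s) (g t).
      have : t \in cell (g s) by rewrite gts mem_cell.
      by rewrite -gts cs inE => /eqP->.
    move=> gst; have [q [pth lst unq cov]] :=
      labels_connected (imset_f g sX) (imset_f g tX) gst.
    have sub : {subset g s :: q <= g @: X} by move=> i; rewrite cov.
    have [p [pthp gp pX pc]] := point_cells_path pth sub sX erefl cs.
    have : g t \in [seq g u | u <- s :: p] by rewrite /= gp cov imset_f.
    case/mapP=> u; rewrite inE => up gtu.
    have cu : cell (g u) = [set u] by case/predU1P: up => [->|/pc].
    by have := mem_cell tX; rewrite gtu cu inE => /eqP->.
  move=> a b aX bX cab.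
  have gab : g a != g b.
    apply: contraNneq cab => gab; have := mem_cell aX; have := mem_cell bX.
    by rewrite -gab (points a aX) !inE => /eqP->.
  have [q [pth lst unq cov]] :=
    labels_connected (imset_f g aX) (imset_f g bX) gab.
  have sub : {subset g a :: q <= g @: X} by move=> i; rewrite cov.
  have [p [pthp gp pX pc]] := point_cells_path pth sub aX erefl (points a aX).
  have cov' u : u \in X -> u \in a :: p.
    move=> uX; have : g u \in [seq g v | v <- a :: p].
      by rewrite /= gp cov imset_f.
    case/mapP=> v vp guv; have vX : v \in X.
      by move: vp; rewrite inE => /predU1P[->|/pX].
    have := mem_cell uX; rewrite guv (points v vX) inE => /eqP->.
    by [].
  exists p; split=> //.
  - have lX : last a p \in X.
      by have := mem_last a p; rewrite inE => /predU1P[->|/pX].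
    have := mem_cell bX; rewrite -lst -gp last_map (points _ lX) inE.
    by move=> /eqP.
  - by apply: (@map_uniq _ _ g); rewrite /= gp.
  - move=> u; apply/idP/idP=> [|/cov' //].
    by rewrite inE => /predU1P[->|/pX].
have lac : {in X, forall s, laceable_on (cell (g s)) /\
    exists s' t', [/\ s' \in cell (g s), t' \in cell (g s) & c s' != c t']}.
  move=> s sX; have [[s' cs]|[]//] := cells_good sX.
  have := mem_cell sX; rewrite cs inE => /eqP sE.
  by case/negP: nopoint; apply/exists_inP; exists s => //; rewrite cs sE.
move=> a b aX bX cab; have [gab|gab] := eqVneq (g a) (g b); last first.
  have [q [pth lst unq cov]] :=
    labels_connected (imset_f g aX) (imset_f g bX) gab.
  have [|p [pthp lstp unqp covp]] :=
    lift_path_through_cells pth unq _ lac aX bX erefl (esym lst) cab.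
    by move=> i; rewrite cov.
  exists p; split=> // s; rewrite covp cov.
  by case sX: (s \in X) => //=; rewrite imset_f.
have bCa : b \in cell (g a) by rewrite gab mem_cell.
have [p [pthp lstp unqp covp]] := (lac a aX).1 a b (mem_cell aX) bCa cab.
case: p pthp lstp unqp covp => [_ /= ab|a' p]; first by rewrite ab eqxx in cab.
move=> /= /andP[eaa' pthp] lstp /andP[anotin unqp] covp.
have /andP[a'X /eqP ga'] : (a' \in X) && (g a' == g a).
  by have := covp a'; rewrite !inE eqxx orbT => /esym.
have [u [q [uX rau eau [pthq lstq unqq covq]]]] := next a aX.
case: q pthq lstq unqq covq => [|j q] /=.
  move=> _ _ _ cov.
  have gE s : s \in X -> g s = g a.
    by move=> sX; have := imset_f g sX; rewrite -cov inE => /eqP.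
  by rewrite (gE s0) ?(gE s1) ?eqxx in gs10.
move=> /andP[raj pthq] lstq /andP[gan unqq] covq.
have jL : j \in g @: X by rewrite -covq !inE eqxx orbT.
have [t [tX gt eat]] := cell_step aX jL raj.
have [|t' [t'X gt' ea't']] := cell_step a'X (imset_f g uX); first by rewrite ga'.
have ctt' : c t != c t'.
  by move: (c_proper eaa') (c_proper eat) (c_proper ea't');
    case: (c a); case: (c a'); case: (c t); case: (c t').
have [||p2 [pth2 lst2 unq2 cov2]] :=
    lift_path_through_cells pthq unqq _ lac tX t'X gt _ ctt'.
- by move=> k kq; rewrite -covq inE kq orbT.
- by rewrite lstq.
exists (t :: p2 ++ a' :: p); split.
- by rewrite /= eat cat_path pth2 lst2 /= e_sym ea't' pthp.
- by rewrite /= last_cat.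
- change (uniq (a :: (t :: p2) ++ a' :: p)).
  rewrite cons_uniq mem_cat (negPf anotin) orbF cov2 (negPf gan) andbF.
  rewrite -[~~ false]/true andTb cat_uniq unq2 -[uniq (a' :: p)]/(_ && _) unqp.
  rewrite andbT; apply/hasPn=> s sp.
  have := covp s; rewrite inE sp orbT => /esym; rewrite inE => /andP[sX /eqP gs].
  by rewrite cov2 gs (negPf gan) andbF.
- move=> s; change (s \in (a :: (t :: p2) ++ a' :: p) = (s \in X)).
  rewrite in_cons mem_cat orbCA -in_cons covp cov2 [s \in cell _]inE -andb_orr.
  case sX: (s \in X) => //=; have := covq (g s).
  by rewrite (imset_f g sX) in_cons orbC.
Qed.

End Gluing.
(** * Realizations and 2-switches *)

Lemma eq_set2 (T : finType) (a b c e : T) :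
  ([set a; b] == [set c; e]) =
  (a == c) && (b == e) || (a == e) && (b == c).
Proof.
apply/eqP/idP=> [E|/orP[]/andP[/eqP-> /eqP->] //]; last exact: setUC.
have: [&& a \in [set c; e], b \in [set c; e], c \in [set a; b] & e \in [set a; b]].
  by rewrite -E !E !(set21, set22) -E !(set21, set22).
rewrite !inE ![c == _]eq_sym ![e == _]eq_sym.
by case: (a == c); case: (a == e); case: (b == c); case: (b == e).
Qed.

Lemma mem_symdiff (V : finType) (E F : {set {set V}}) a :
  (a \in symdiff E F) = (a \in E) (+) (a \in F).
Proof. by rewrite !inE; case: (a \in E); case: (a \in F). Qed.

(** The edge set of the cycle u x v y; a 2-switch is a symmetric difference with
    such a set. *)
Definition four_cycle (V : finType) (u v x y : V) : {set {set V}} :=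
  [set [set u; x]; [set v; y]; [set u; y]; [set v; x]].

Section FourCycle.
Variables (V : finType).
Implicit Types u v x y p q : V.

Lemma four_cycle_uniq u v x y : u != v -> x != y -> u != y -> v != x -> u != x ->
  uniq [:: [set u; x]; [set v; y]; [set u; y]; [set v; x]].
Proof.
move=> /negPf uv /negPf xy /negPf uy /negPf vx /negPf ux.
rewrite /= !inE !eq_set2 !negb_or !eqxx uv uy vx xy ux.
by rewrite (eq_sym x v) (eq_sym y u) (eq_sym v u) (eq_sym y x) uv xy vx uy !andbF.
Qed.

(** In this form, symmetric differences of four-cycles are computed by
    cancellation. *)
Lemma mem_four_cycle u v x y a : u != v -> x != y -> u != y -> v != x -> u != x ->
  (a \in four_cycle u v x y) = (a == [set u; x]) (+) (a == [set v; y])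
     (+) (a == [set u; y]) (+) (a == [set v; x]).
Proof.
move=> uv xy uy vx ux; have := four_cycle_uniq uv xy uy vx ux.
rewrite !inE /= !inE !negb_or andbT => /and3P[/and3P[n1 n2 n3] /andP[n4 n5] n6].
case: eqVneq => [->|_]; first by rewrite (negPf n1) (negPf n2) (negPf n3).
case: eqVneq => [->|_]; first by rewrite (negPf n4) (negPf n5).
by case: eqVneq => [->|_]; [rewrite (negPf n6) | case: (a == _)].
Qed.

Lemma card_four_cycle u v x y : u != v -> x != y -> u != y -> v != x -> u != x ->
  #|four_cycle u v x y| = 4.
Proof.
move=> uv xy uy vx ux; have /card_uniqP /= <- := four_cycle_uniq uv xy uy vx ux.
by apply: eq_card => a; rewrite !inE -!orbA.
Qed.

Lemma four_cycleP u v x y p q :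
  ([set p; q] \in four_cycle u v x y) =
  (p \in pred2 u v) && (q \in pred2 x y) || (p \in pred2 x y) && (q \in pred2 u v).
Proof.
rewrite !inE !eq_set2; do ![case: (_ == _) => //=].
Qed.
End FourCycle.

Lemma card_filter_pair (T : finType) (p : pred T) (a b : T) : a != b ->
  #|[set t in [set a; b] | p t]| = p a + p b.
Proof.
move=> ab; rewrite -sum1_card (eq_bigl (fun t => (t \in [set a; b]) && p t)).
  by rewrite big_mkcondr big_setU1 ?inE //= big_set1; case: (p a); case: (p b).
by move=> t; rewrite inE.
Qed.

Lemma mem_incident (V : finType) (E : {set {set V}}) (w : V) a :
  (a \in [set b in E | w \in b]) = (a \in E) && (w \in a).
Proof. by rewrite inE. Qed.

Section Realizations.
Variables (V : finType) (d : V -> 'I_#|V|).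
Implicit Types (S T : realization d) (u v x y p q : V).

Definition adj S u v : bool := [set u; v] \in val S.
Definition nbr S u : {set V} := [set v | adj S u v].

Lemma adjC S u v : adj S u v = adj S v u.
Proof. by rewrite /adj setUC. Qed.

Lemma edge_card S a : a \in val S -> #|a| = 2.
Proof. by case/andP: (valP S) => /forall_inP cS _ /cS/eqP. Qed.

Lemma adj_irr S u : adj S u u = false.
Proof. by apply/negP=> /edge_card; rewrite setUid cards1. Qed.

Lemma adj_neq S u v : adj S u v -> u != v.
Proof. by apply: contraTneq => ->; rewrite adj_irr. Qed.

Lemma card_nbr S u : #|nbr S u| = d u.
Proof.
case/andP: (valP S) => _ /forallP/(_ u)/eqP<-; rewrite /degree.
rewrite -(@card_in_imset _ _ (fun w => [set u; w]) (nbr S u)); last first.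
  move=> v w _ _ /eqP; rewrite eq_set2 eqxx /= => /orP[/eqP//|].
  by case/andP=> /eqP-> /eqP.
apply: eq_card => a; rewrite inE; apply/imsetP/andP=> [[w]|[aS ua]].
  by rewrite inE => uw ->; rewrite set21.
have /eqP/cards2P[x [y [xy ax]]] := edge_card aS.
move: ua; rewrite ax !inE => /orP[]/eqP->; first by exists y; rewrite // inE /adj -ax.
by exists x; rewrite ?inE /adj setUC // -ax.
Qed.

Lemma realization_eq S T : (forall u v, adj S u v = adj T u v) -> S = T.
Proof.
move=> ST; apply/val_inj/setP=> a.
have [/cards2P[x [y [_ ->]]]|c2] := boolP (#|a| == 2); first exact: ST.
by apply/idP/idP=> /edge_card/eqP; rewrite (negPf c2).
Qed.

(** The clause x != v discards the edge uv itself, which says nothing about how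
    the neighbourhoods of u and v differ elsewhere. *)
Definition private S u v x : bool := [&& adj S u x, ~~ adj S v x & x != v].

Definition alternating S u v x y : bool := private S u v x && private S v u y.

Lemma alternatingC S u v x y : alternating S u v x y = alternating S v u y x.
Proof. by rewrite /alternating andbC. Qed.

(** The four-cycle u x v y alternates; the roles of its two diagonals are
    exchanged. *)
Lemma alternating_dual S u v x y : alternating S u v x y = alternating S x y u v.
Proof.
rewrite /alternating /private !(adjC S x) !(adjC S y) (eq_sym x) (eq_sym y).
by case: (adj S u x); case: (adj S v y); case: (adj S u y); case: (adj S v x);
  rewrite ?(eq_sym v) ?(eq_sym u) //= ?andbF // andbC.
Qed.

Lemma alternating_neq S u v x y : alternating S u v x y ->
  [/\ u != v, x != y, u != y & v != x].
Proof.
case/andP=> /and3P[ux vx xv] /and3P[vy uy yu]; split; last 2 first.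
- by rewrite eq_sym.
- by rewrite eq_sym.
- by apply: contraNneq vx => <-.
- by apply: contraNneq vx => ->.
Qed.

Definition switched S u v x y : {set {set V}} :=
  symdiff (val S) (four_cycle u v x y).

Lemma switched_realization S u v x y :
  alternating S u v x y -> is_realization d (switched S u v x y).
Proof.
move=> alt; have [uv xy uy vx] := alternating_neq alt.
case/andP: (alt) => /and3P[aux avx _] /and3P[avy auy _].
have ux := adj_neq aux; have vy := adj_neq avy.
apply/andP; split.
  apply/forall_inP=> a; rewrite mem_symdiff; case aS: (a \in val S).
    by rewrite (edge_card aS).
  by rewrite /= !inE -!orbA => /or4P[]/eqP->; rewrite cards2 ?ux ?vy ?uy ?vx.
apply/forallP=> w; case/andP: (valP S) => _ /forallP/(_ w)/eqP<-; apply/eqP.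
have Eux : [set u; x] \in val S := aux; have Evy : [set v; y] \in val S := avy.
have Euy : [set u; y] \notin val S := auy; have Evx : [set v; x] \notin val S := avx.
rewrite /degree -[LHS](cardsID (four_cycle u v x y)).
rewrite -[RHS](cardsID (four_cycle u v x y)); congr (_ + _); last first.
  by apply: eq_card => a; rewrite !in_setD !mem_incident mem_symdiff;
    case: (a \in four_cycle _ _ _ _);
    rewrite // addbF.
have uxvy : [set u; x] != [set v; y] by rewrite eq_set2 (negPf uv) (negPf uy).
have uyvx : [set u; y] != [set v; x] by rewrite eq_set2 (negPf uv) (negPf ux).
transitivity #|[set a in [set [set u; y]; [set v; x]] | w \in a]|.
  apply: eq_card => a; rewrite in_setI !mem_incident mem_symdiff.
  case aC: (a \in four_cycle _ _ _ _); last first.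
    by move: aC; rewrite andbF !inE; do ![case: (_ == _) => //=].
  rewrite andbT addbT; congr (_ && _).
  move: aC; rewrite !inE -!orbA => /or4P[]/eqP->.
  - by rewrite Eux !eq_set2 !eqxx (negPf uv) (negPf xy) (negPf ux) (negPf uy).
  - rewrite Evy !eq_set2 !eqxx (negPf vx) (eq_sym v u) (negPf uv).
    by rewrite (negPf vy) (eq_sym y x) (negPf xy) andbF.
  - by rewrite eqxx (negPf Euy).
  - by rewrite eqxx (negPf Evx) orbT.
transitivity #|[set a in [set [set u; x]; [set v; y]] | w \in a]|; last first.
  apply: eq_card => a; rewrite !inE.
  case: eqVneq => [->|_] /=; first by rewrite Eux andbT.
  case: eqVneq => [->|_] /=; first by rewrite Evy andbT.
  case: eqVneq => [->|_] /=; first by rewrite (negPf Euy).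
  case: eqVneq => [->|_] /=; first by rewrite (negPf Evx).
  by rewrite andbF.
rewrite !card_filter_pair // !inE.
case: (eqVneq w u) => [->|_]; first by rewrite (negPf uv) (negPf uy) (negPf ux).
case: (eqVneq w v) => [->|_]; first by rewrite (negPf vx) (negPf vy).
case: (eqVneq w x) => [->|_]; first by rewrite (negPf xy).
by case: (w == y).
Qed.
Definition switch S u v x y (alt : alternating S u v x y) : realization d :=
  exist _ (switched S u v x y) (switched_realization alt).

Lemma adj_switch S u v x y (alt : alternating S u v x y) p q :
  adj (switch alt) p q = adj S p q (+) ([set p; q] \in four_cycle u v x y).
Proof. by rewrite /adj /= mem_symdiff. Qed.

Lemma alternating_four_cycle_card S u v x y : alternating S u v x y ->
  #|four_cycle u v x y| = 4.
Proof.
move=> alt; have [uv xy uy vx] := alternating_neq alt.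
by case/andP: alt => /and3P[/adj_neq ux _ _] _; apply: card_four_cycle.
Qed.

Lemma realization_adj_switch S u v x y (alt : alternating S u v x y) :
  realization_adj d S (switch alt).
Proof.
rewrite /realization_adj -(alternating_four_cycle_card alt); apply/eqP.
apply: eq_card => a; rewrite mem_symdiff [a \in val (switch _)]mem_symdiff.
by case: (a \in val S); case: (a \in _).
Qed.

Lemma sum_degree (E : {set {set V}}) : is_edge_set E ->
  \sum_w degree E w = #|E| * 2.
Proof.
move=> /forall_inP cE; rewrite /degree.
under eq_bigr => w _ do rewrite -sum1_card (eq_bigl _ _ (mem_incident E w)).
rewrite (exchange_big_dep (mem E)) /=; last by move=> w a _ /andP[].
rewrite -sum_nat_const; apply: eq_bigr => a aE.
rewrite -(eqP (cE a aE)) -sum1_card; apply: eq_bigl => w.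
by rewrite aE.
Qed.

(** Both realizations have the same degree at w, and common edges cancel. *)
Lemma degree_setD S T w :
  degree (val S :\: val T) w = degree (val T :\: val S) w.
Proof.
have degE (R : realization d) : degree (val R) w = d w.
  by case/andP: (valP R) => _ /forallP/(_ w)/eqP.
have split (R Q : realization d) : degree (val R) w =
    #|[set a in val R :&: val Q | w \in a]| + degree (val R :\: val Q) w.
  rewrite /degree -[LHS](cardsID (val Q)); congr (_ + _);
    apply: eq_card => a; rewrite ?in_setI ?in_setD !mem_incident ?in_setI ?in_setD.
    by rewrite andbAC.
  by rewrite andbA.
have := split S T; rewrite degE -(degE T) (split T S) setIC.
by move=> /addnI.
Qed.

(** Adjacency in the realization graph is a 2-switch: the two sides of the
    symmetric difference have equal degrees everywhere, hence two edges each, and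
    two disjoint edges can only be exchanged for another perfect matching of their
    ends. *)
Lemma adjacent_alternating S T : realization_adj d S T ->
  exists u v x y, alternating S u v x y /\ val T = switched S u v x y.
Proof.
set A := val S :\: val T; set B := val T :\: val S => adjST.
have edgeA : is_edge_set A.
  by apply/forall_inP=> a; rewrite inE => /andP[_ /edge_card->].
have edgeB : is_edge_set B.
  by apply/forall_inP=> a; rewrite inE => /andP[_ /edge_card->].
have degAB : degree A =1 degree B by move=> w; apply: degree_setD.
have cAB : #|A| = #|B|.
  apply/eqP; rewrite -(eqn_pmul2r (isT : 0 < 2)) -!sum_degree //.
  by apply/eqP/eq_bigr.
have disjAB : [disjoint A & B].
  rewrite -setI_eq0; apply/eqP/setP=> a; rewrite !inE.
  by case: (a \in val S); rewrite /= ?andbF.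
have /eqP := adjST; rewrite /symdiff -/A -/B cardsU.
rewrite (eqP (_ : A :&: B == set0)) ?setI_eq0 // cards0 subn0 -cAB addnn => dA.
have /eqP/cards2P[e1 [e2 [e12 defA]]] : #|A| = 2 by rewrite -[LHS]doubleK dA.
have /eqP/cards2P[f1 [f2 [f12 defB]]] : #|B| = 2.
  by rewrite -[LHS]doubleK -cAB dA.
have bal w : (w \in e1) + (w \in e2) = (w \in f1) + (w \in f2).
  by have := degAB w; rewrite /degree defA defB !card_filter_pair.
have e1A : e1 \in A by rewrite defA set21.
have e2A : e2 \in A by rewrite defA set22.
have f1B : f1 \in B by rewrite defB set21.
have f2B : f2 \in B by rewrite defB set22.
have eNf e f : e \in A -> f \in B -> e != f.
  by move=> eA fB; apply: contraTneq eA => ->; rewrite (disjointFl disjAB).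
have two_elt f w z : f \in A :|: B -> w \in f -> z \in f -> w != z ->
    f = [set w; z].
  move=> fAB wf zf wz; apply/esym/eqP; rewrite eqEcard cards2 wz subUset !sub1set.
  rewrite wf zf /=; move: fAB; rewrite inE => /orP[]fE.
    by rewrite (eqP (forall_inP edgeA f fE)).
  by rewrite (eqP (forall_inP edgeB f fE)).
have inA e : e \in A -> e \in A :|: B by move=> eA; rewrite inE eA.
have inB f : f \in B -> f \in A :|: B by move=> fB; rewrite inE fB orbT.
(* If e1 and e2 shared w, both f1 and f2 would contain w, and the other end of e1
   would force one of them to be e1. *)
have disj w : w \in e1 -> w \notin e2.
  move=> we1; apply/negP=> we2; have := bal w; rewrite we1 we2.
  have [x xw xe1] : exists2 x, x != w & x \in e1.
    have /cards2P[p [q [pq e1E]]] := forall_inP edgeA e1 e1A.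
    have [wp|wp] := eqVneq w p.
      by exists q; rewrite ?wp 1?eq_sym // e1E set22.
    by exists p; rewrite 1?eq_sym // e1E set21.
  have := bal x; rewrite xe1.
  have e1E : e1 = [set x; w] by apply: two_elt => //; apply: inA.
  have fNx f : f \in B -> x \in f -> w \notin f.
    move=> fB xf; apply/negP=> wf.
    by have := eNf _ _ e1A fB; rewrite e1E (two_elt f x w) ?eqxx //; apply: inB.
  case xf1: (x \in f1); first by rewrite (negPf (fNx f1 f1B xf1)); case: (w \in f2).
  case xf2: (x \in f2); last by [].
  by rewrite (negPf (fNx f2 f2B xf2)); case: (w \in f1).
(* The ends are named so that one added edge joins u to y. *)
have finish u v x y f f' : e1 = [set u; x] -> e2 = [set v; y] ->
    B = [set f; f'] -> f != f' -> u \in f -> y \in f ->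
    exists u v x y, alternating S u v x y /\ val T = switched S u v x y.
  move=> e1E e2E BE ff' uf yf.
  have fB : f \in B by rewrite BE set21.
  have f'B : f' \in B by rewrite BE set22.
  have bal' w : (w \in e1) + (w \in e2) = (w \in f) + (w \in f').
    by have := degAB w; rewrite /degree defA BE !card_filter_pair.
  have uy : u != y.
    have : u \notin e2 by apply: disj; rewrite e1E set21.
    by apply: contraNneq => ->; rewrite e2E set22.
  have vx : v != x.
    have : x \notin e2 by apply: disj; rewrite e1E set22.
    by apply: contraNneq => <-; rewrite e2E set21.
  have ux : u != x by apply: (@adj_neq S); move: e1A; rewrite e1E inE => /andP[].
  have vy : v != y by apply: (@adj_neq S); move: e2A; rewrite e2E inE => /andP[].
  have fE : f = [set u; y] by apply: two_elt => //; apply: inB.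
  have xf : x \notin f.
    apply/negP=> xf; have := eNf _ _ e1A fB.
    by rewrite e1E (two_elt f u x) ?eqxx //; apply: inB.
  have vf : v \notin f.
    apply/negP=> vf; have := eNf _ _ e2A fB.
    by rewrite e2E (two_elt f v y) ?eqxx //; apply: inB.
  have xf' : x \in f'.
    by have := bal' x; rewrite (negPf xf) e1E set22; case: (x \in f').
  have vf' : v \in f'.
    have := bal' v; rewrite (negPf vf) e2E set21 addnC.
    by case: (v \in f').
  have f'E : f' = [set v; x] by apply: two_elt => //; apply: inB.
  move: fB f'B e1A e2A; rewrite fE f'E e1E e2E !inE.
  move=> /andP[uyS uyT] /andP[vxS vxT] /andP[uxT uxS] /andP[vyT vyS].
  exists u, v, x, y; split.
    by rewrite /alternating /private /adj uxS vxS vyS uyS (eq_sym x) vx eq_sym uy.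
  apply/setP=> a; rewrite mem_symdiff.
  have -> : (a \in four_cycle u v x y) = (a \in A) || (a \in B).
    by rewrite defA BE fE f'E e1E e2E !inE -!orbA.
  by rewrite !inE; case: (a \in val S); case: (a \in val T).
have /cards2P[u [x [ux e1E]]] := forall_inP edgeA e1 e1A.
have /cards2P[v [y [vy e2E]]] := forall_inP edgeA e2 e2A.
have ue1 : u \in e1 by rewrite e1E set21.
have through f f' : B = [set f; f'] -> f != f' -> u \in f ->
    exists u v x y, alternating S u v x y /\ val T = switched S u v x y.
  move=> BE ff' uf; have fB : f \in B by rewrite BE set21.
  have [yf|yf] := boolP (y \in f); first exact: (finish u v x y f f').
  have [vf|vf] := boolP (v \in f).
    by apply: (finish u y x v f f') => //; rewrite e2E setUC.
  have /cards2P[p [q [pq fE]]] := forall_inP edgeB f fB.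
  have [z zf zu] : exists2 z, z \in f & z != u.
    have [up|up] := eqVneq u p; first by exists q; rewrite ?up 1?eq_sym // fE set22.
    by exists p; rewrite 1?eq_sym // fE set21.
  have := degAB z; rewrite /degree defA BE !card_filter_pair // zf.
  have ze2 : z \notin e2.
    rewrite e2E !inE negb_or; apply/andP.
    by split; [apply: contraNneq vf => <- | apply: contraNneq yf => <-].
  have ze1 : z \notin e1.
    rewrite e1E !inE (negPf zu) /=; apply: contraTneq zf => ->; apply/negP=> xf.
    by have := eNf _ _ e1A fB; rewrite e1E (two_elt f u x) ?eqxx //; apply: inB.
  by rewrite (negPf ze1) (negPf ze2).
have := bal u; rewrite ue1.
case uf1: (u \in f1); first by move=> _; apply: (through f1 f2).
case uf2: (u \in f2) => // _; apply: (through f2 f1) => //; first by rewrite defB setUC.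
by rewrite eq_sym.
Qed.
End Realizations.
(** * Local structure when the realization graph is triangle-free *)

Section TriangleFree.
Variables (V : finType) (d : V -> 'I_#|V|).
Hypothesis tf : triangle_free (realization_adj d).
Implicit Types (F : {set V}) (R S T : realization d) (u v w x y : V).

(** Two switches of S whose four-cycles differ by a four-cycle form a triangle
    with S. *)
Lemma no_theta S u v x y u' v' x' y' p q r s :
    alternating S u v x y -> alternating S u' v' x' y' ->
    [/\ p != q, r != s, p != s, q != r & p != r] ->
  symdiff (four_cycle u v x y) (four_cycle u' v' x' y') <> four_cycle p q r s.
Proof.
move=> alt alt' [pq rs ps qr pr] CC'.
apply: (tf (And3 (realization_adj_switch alt) _ (realization_adj_switch alt'))).
rewrite /realization_adj -(card_four_cycle pq rs ps qr pr) -CC'; apply/eqP.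
apply: eq_card => a; rewrite mem_symdiff mem_symdiff.
rewrite [a \in val (switch alt)]mem_symdiff [a \in val (switch alt')]mem_symdiff.
by case: (a \in val S); do 2 case: (a \in four_cycle _ _ _ _).
Qed.

(** Otherwise the switches with x and with x' would be adjacent, as they differ
    by the four-cycle u x v x'. *)
Lemma private_unique S u v x y x' :
  alternating S u v x y -> private S u v x' -> x' = x.
Proof.
move=> alt pr; apply/eqP; apply: contraT; rewrite eq_sym => xx'.
have alt' : alternating S u v x' y.
  by rewrite /alternating pr; case/andP: alt.
have [uv xy uy vx] := alternating_neq alt.
have [_ x'y _ vx'] := alternating_neq alt'.
have ux : u != x by case/andP: alt => /and3P[/adj_neq].
have ux' : u != x' by case/and3P: pr => /adj_neq.
case: (no_theta (p := u) (q := v) (r := x) (s := x') alt alt') => //.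
apply/setP=> a; rewrite mem_symdiff !mem_four_cycle //.
case: (a == [set u; x]); case: (a == [set v; y]); case: (a == [set u; y]);
 case: (a == [set v; x]); case: (a == [set u; x']); case: (a == [set v; x']);
 by [].
Qed.

(** If both or neither of uv and xy were edges, the three perfect matchings of
    u, v, x, y would give three mutually adjacent realizations. *)
Lemma alternating_P4 S u v x y : alternating S u v x y -> adj S u v != adj S x y.
Proof.
move=> alt; apply/negP=> /eqP uvxy.
have [uv xy uy vx] := alternating_neq alt.
have ux : u != x by case/andP: alt => /and3P[/adj_neq].
have vy : v != y by case/andP: alt => _ /and3P[/adj_neq].
case/andP: (alt) => /and3P[aux avx xv] /and3P[avy auy yu].
have [auv|auv] := boolP (adj S u v).
  have alt' : alternating S u x v y.
    by rewrite /alternating /private auv -uvxy auv auy adjC avx vx yu.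
  case: (no_theta (p := u) (q := y) (r := x) (s := v) alt alt'); first by rewrite (eq_sym y).
  apply/setP=> a; rewrite mem_symdiff !mem_four_cycle // 1?(eq_sym y) //.
  rewrite (setUC [set y] [set x]) (setUC [set y] [set v]) (setUC [set x] [set v]).
  case: (a == [set u; x]); case: (a == [set v; y]); case: (a == [set u; y]);
  case: (a == [set v; x]); case: (a == [set u; v]); case: (a == [set x; y]);
  by [].
have alt' : alternating S u y x v.
  by rewrite /alternating /private aux (adjC S y x) -uvxy (adjC S y v) avy auv
             xy (eq_sym v) uv.
case: (no_theta (p := u) (q := x) (r := v) (s := y) alt alt') => //.
apply/setP=> a; rewrite mem_symdiff !mem_four_cycle // 1?(eq_sym y) // 1?(eq_sym x) //.
rewrite (setUC [set y] [set x]) (setUC [set y] [set v]) (setUC [set x] [set v]).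
case: (a == [set u; x]); case: (a == [set v; y]); case: (a == [set u; y]);
case: (a == [set v; x]); case: (a == [set u; v]); case: (a == [set x; y]);
by [].
Qed.

(** Common neighbours, and the edge uv, contribute equally to both degrees. *)
Lemma card_private S u v : u != v ->
  d u + #|[set x | private S v u x]| = d v + #|[set x | private S u v x]|.
Proof.
have nbrE p q : p != q -> #|nbr S p| = adj S p q + #|nbr S p :&: nbr S q| +
    #|[set x | private S p q x]|.
  move=> pq; rewrite (cardsD1 q) inE -addnA; congr (_ + _).
  rewrite -[LHS](cardsID (nbr S q)); congr (_ + _); apply: eq_card => x; rewrite !inE.
    case: eqVneq => [->|] //=; rewrite adj_irr andbF //.
  by rewrite /private; case: (x == q); case: (adj S p x); case: (adj S q x).
move=> uv; have := nbrE u v uv; have := nbrE v u.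
rewrite eq_sym uv !card_nbr => -> // ->.
by rewrite (adjC S v) (setIC (nbr S v)) addnAC.
Qed.

Lemma alternating_degree S u v x y : alternating S u v x y -> d u = d v.
Proof.
move=> alt; have [uv _ _ _] := alternating_neq alt.
have cards1 p q z t : alternating S p q z t -> #|[set x | private S p q x]| = 1.
  move=> pqzt; apply/eqP/cards1P; exists z; apply/setP=> w; rewrite !inE.
  apply/idP/eqP=> [|->]; first exact: private_unique pqzt.
  by case/andP: pqzt.
have altC : alternating S v u y x by rewrite alternatingC.
have := card_private S uv; rewrite (cards1 _ _ _ _ alt) (cards1 _ _ _ _ altC).
by move/addIn/val_inj.
Qed.

Lemma private_alternating S u v x : d u = d v -> private S u v x ->
  exists y, alternating S u v x y.
Proof.
move=> duv pr; have uv : u != v.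
  by apply: contraTneq pr => ->; rewrite /private; case: (adj S v x).
have := card_private S uv; rewrite duv => /addnI eqc.
have : 0 < #|[set z | private S v u z]|.
  by rewrite eqc; apply/card_gt0P; exists x; rewrite inE.
by case/card_gt0P=> y; rewrite inE => pr'; exists y; rewrite /alternating pr.
Qed.

Definition active S u v : bool := [exists x, exists y, alternating S u v x y].

Lemma activeP S u v :
  reflect (exists x y, alternating S u v x y) (active S u v).
Proof.
apply: (iffP existsP) => [[x /existsP[y alt]]|[x [y alt]]]; first by exists x, y.
by exists x; apply/existsP; exists y.
Qed.

Lemma activeC S u v : active S u v = active S v u.
Proof.
by apply/activeP/activeP=> [] [x [y alt]]; exists y, x; rewrite alternatingC.
Qed.

(** If v were a twin of u, then depending on the position of v with respect to x
    and y one gets a second private neighbour, an induced 2K_2 or an induced C_4. *)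
Lemma active_class S u v w : active S u w -> d v = d u -> v != u -> active S u v.
Proof.
case/activeP=> x [y alt] dvu vu; apply: contraT => nact.
have twin z : z != u -> z != v -> adj S u z = adj S v z.
  move=> zu zv; apply/idP/idP=> az; apply: contraT => naz; case/negP: nact.
    have [|t tP] := @private_alternating S u v z (esym dvu); first exact/and3P.
    by apply/activeP; exists z, t.
  have [|t tP] := @private_alternating S v u z dvu; first exact/and3P.
  by rewrite activeC; apply/activeP; exists z, t.
have P4 := alternating_P4 alt.
case/andP: (alt) => /and3P[aux awx xw] /and3P[awy auy yu].
have [uw xy uy wx] := alternating_neq alt.
have ux := adj_neq aux.
have [vx|vx] := eqVneq v x.
  have nawu : ~~ adj S w u by rewrite adjC (twin w) 1?eq_sym // ?vx // adjC.
  have naxy : ~~ adj S x y by rewrite -vx -(twin y) // vx eq_sym.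
  by move: P4; rewrite (adjC S u w) (negPf nawu) (negPf naxy).
have [vy|vy] := eqVneq v y.
  move: P4; have awu : adj S u w.
    have wv : w != v by rewrite vy (adj_neq awy).
    by rewrite twin // 1?eq_sym // vy adjC.
  have axy : adj S x y by rewrite adjC -vy -twin // eq_sym.
  by rewrite awu axy.
have prv : private S x y v.
  have xv : x != v by rewrite eq_sym.
  have yv : y != v by rewrite eq_sym.
  have xu : x != u by rewrite eq_sym.
  by rewrite /private !(adjC S _ v) -!twin // aux auy vy.
have := private_unique (y := w) (x := u) _ prv.
by rewrite alternating_dual => /(_ alt)/eqP; rewrite (negPf vu).
Qed.

Lemma private_implies_third S u v w x y : alternating S u v x y -> d w = d u ->
  w != u -> w != v -> w != x -> w != y -> adj S w x -> adj S w y.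
Proof.
move=> alt dwu wu wv wx wy awx; apply: contraT => nawy.
have [uv xy uy vx] := alternating_neq alt.
case/andP: (alt) => /and3P[aux avx xv] /and3P[avy auy yu].
have altwv : alternating S w v x y.
  by rewrite /alternating /private awx avx xv avy nawy eq_sym wy.
have actuw : active S u w.
  by apply: (@active_class S u w v) => //; apply/activeP; exists x, y.
have [a [b altuw]] := activeP _ _ _ actuw.
case/andP: (altuw) => /and3P[aua awa aw] /and3P[awb aub bu].
have [av|av] := eqVneq a v.
  have [bv|bv] := eqVneq b v; first by rewrite av -bv awb in awa.
  have [avb|avb] := boolP (adj S v b).
    have by_ : b = y.
      by apply: (@private_unique S v u y x); rewrite 1?alternatingC // /private avb aub.
    by rewrite -by_ awb in nawy.
  have bx : b = x by apply: (private_unique altwv); rewrite /private awb avb.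
  by rewrite bx aux in aub.
have [ava|ava] := boolP (adj S v a).
  have ay : a = y.
    by apply: (@private_unique S v w y x); rewrite 1?alternatingC // /private ava awa.
  by rewrite -ay aua in auy.
have ax : a = x by apply: (private_unique alt); rewrite /private aua ava.
by rewrite -ax (negPf awa) in awx.
Qed.

(** If w were adjacent to x but not to y, then x and y would also be the private
    neighbours of w and v, and uniqueness would leave no vertex that can be private
    to u with respect to w. *)
Lemma private_pair_third S u v w x y : alternating S u v x y -> d w = d u ->
  w != u -> w != v -> w != x -> w != y -> adj S w x = adj S w y.
Proof.
move=> alt dwu wu wv wx wy; apply/idP/idP; first exact: (private_implies_third alt).
move=> awy; rewrite alternatingC in alt; apply: (private_implies_third alt) => //.
by rewrite dwu -(alternating_degree alt).
Qed.

(** The path u x y v closes up, through the private neighbour z of v with respect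
    to x, to an induced 5-cycle inside the degree class. Applied to the pairs at
    distance two, [private_pair_third] makes any further vertex of the class adjacent
    to all of the cycle or to none of it; either way, it would differ from u in two
    private neighbours. *)
Lemma card_class_of_P4 S u v x y : alternating S u v x y -> d u = d x -> adj S x y ->
  #|[set w | d w == d u]| <= 5.
Proof.
move=> alt dux axy; have duv := alternating_degree alt.
have altd : alternating S x y u v by rewrite -alternating_dual.
have dxy := alternating_degree altd.
have [uv xy uy vx] := alternating_neq alt.
case/andP: (alt) => /and3P[aux avx xv] /and3P[avy auy yu].
have auv : ~~ adj S u v by have := alternating_P4 alt; rewrite axy; case: (adj S u v).
have dxv : d x = d v by rewrite -dux.
have [|z altxv] := @private_alternating S x v u dxv.
  by rewrite /private adjC aux adjC auv uv.
case/andP: (altxv) => /and3P[axu avu _] /and3P[avz axz zx].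
have zy : z != y by apply: contraNneq axz => ->.
have zu : z != u by apply: contraTneq avz => ->; rewrite adjC.
have auz : adj S u z.
  apply: contraT => auz; have alt' : alternating S u v x z.
    by rewrite /alternating /private aux avx xv avz auz zu.
  by have := alternating_P4 alt'; rewrite (negPf auv) (negPf axz).
have ayz : ~~ adj S y z.
  apply/negP=> ayz; have alt' : alternating S u z x y.
    by rewrite /alternating /private aux adjC axz eq_sym zx adjC ayz auy yu.
  by have := alternating_P4 alt'; rewrite auz axy.
have zv : z != v by rewrite eq_sym (adj_neq avz).
have altuy : alternating S u y z v.
  by rewrite /alternating /private auz ayz zy adjC avy auv eq_sym uv.
have altxz : alternating S x z y v.
  rewrite /alternating /private axy adjC ayz (eq_sym y) zy adjC avz adjC avx.
  by rewrite (eq_sym v) xv.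
have dz : d z = d x by rewrite (alternating_degree altxz).
suff sub : [set w | d w == d u] \subset [:: u; v; x; y; z].
  by apply: leq_trans (subset_leq_card sub) (card_size _).
apply/subsetP=> w; rewrite inE => /eqP dw; apply: contraT.
rewrite !inE !negb_or => /and5P[wu wv wx wy wz].
have third p q r s : alternating S p q r s -> d p = d u ->
    r \in [:: u; v; x; y; z] -> s \in [:: u; v; x; y; z] ->
    p \in [:: u; v; x; y; z] -> q \in [:: u; v; x; y; z] ->
    adj S w r = adj S w s.
  move=> altp dp; rewrite !inE => rC sC pC qC.
  have neq t : [|| t == u, t == v, t == x, t == y | t == z] -> w != t.
    by case/or4P=> [||| /orP[]] /eqP->.
  by apply: (private_pair_third altp); rewrite ?dp //; apply: neq.
have e1 : adj S w x = adj S w y by apply: (third u v) => //; rewrite !inE eqxx ?orbT.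
have e2 : adj S w u = adj S w z by apply: (third x v) => //; rewrite ?inE ?eqxx ?orbT.
have e3 : adj S w z = adj S w v by apply: (third u y) => //; rewrite ?inE ?eqxx ?orbT.
have e4 : adj S w y = adj S w v by apply: (third x z) => //; rewrite ?inE ?eqxx ?orbT.
have [aww|aww] := boolP (adj S w u).
  have awv : adj S w v by rewrite -e3 -e2.
  have awy : adj S w y by rewrite e4.
  have [|t altw] := @private_alternating S w u v dw.
    by rewrite /private awv auv eq_sym uv.
  have := private_unique altw (x' := y).
  rewrite /private awy auy yu => /(_ isT) yv.
  by rewrite yv adj_irr in avy.
have awz : ~~ adj S w z by rewrite -e2.
have awx : ~~ adj S w x by rewrite e1 e4 -e3.
have [|t altw] := @private_alternating S u w x (esym dw).
  by rewrite /private aux awx eq_sym wx.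
have := private_unique altw (x' := z).
rewrite /private auz awz (eq_sym z) wz => /(_ isT) zx'.
by rewrite zx' eqxx in zx.
Qed.

Lemma card_class_of_switch S u v x y : alternating S u v x y -> d u = d x ->
  #|[set w | d w == d u]| <= 5.
Proof.
move=> alt dux; have [axy|axy] := boolP (adj S x y); first exact: card_class_of_P4 alt _ _.
rewrite dux; apply: (@card_class_of_P4 S x y u v) => //; first by rewrite -alternating_dual.
by have := alternating_P4 alt; rewrite (negPf axy); case: (adj S u v).
Qed.
(** * Possible neighbourhoods of a vertex *)

Lemma private_degree_lt S x y u : private S x y u -> d x != d y -> d y < d x.
Proof.
move=> pr dxy.
have xy : x != y by apply: contraNneq dxy => ->.
have := card_private S xy; rewrite (_ : [set z | private S y x z] = set0); last first.
  apply/setP=> v; rewrite !inE; apply: contraNF dxy => prv.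
  apply/eqP; apply: (@alternating_degree S x y u v); exact/andP.
rewrite cards0 addn0 => ->; rewrite -[X in X < _]addn0 ltn_add2l.
by apply/card_gt0P; exists u; rewrite inE.
Qed.

(** S makes x strictly richer than y unless the degrees agree, and T does the
    opposite. *)
Lemma exchange_private S T u x y :
  x \in nbr S u :\: nbr T u -> y \in nbr T u :\: nbr S u ->
  [/\ private S x y u, private T y x u & d x = d y].
Proof.
rewrite !inE => /andP[naTx aSx] /andP[naSy aTy].
have prS : private S x y u.
  by rewrite /private !(adjC S _ u) aSx naSy (adj_neq aTy).
have prT : private T y x u.
  by rewrite /private !(adjC T _ u) aTy naTx (adj_neq aSx).
split=> //; apply/eqP; apply: contraT => dxy.
have := private_degree_lt prS dxy; rewrite eq_sym in dxy.
by have := private_degree_lt prT dxy; case: ltngtP.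
Qed.

(** Let u and v be the private neighbours of x1 and y1. If v were neither x2 nor
    y2, then x2 and y2 would not separate u from v, so both u and v would be private
    to x2 with respect to y2. Hence v, and with it u, lies in the class of x1. *)
Lemma far_degree S T u x1 x2 y1 y2 :
  x1 \in nbr S u :\: nbr T u -> x2 \in nbr S u :\: nbr T u -> x1 != x2 ->
  y1 \in nbr T u :\: nbr S u -> y2 \in nbr T u :\: nbr S u -> y1 != y2 ->
  d x1 = d u /\ #|[set w | d w == d u]| <= 5.
Proof.
move=> x1N x2N x12 y1N y2N y12.
have [pr11 _ d11] := exchange_private x1N y1N.
have [pr12 _ d12] := exchange_private x1N y2N.
have [pr21 _ d21] := exchange_private x2N y1N.
have [pr22 _ d22] := exchange_private x2N y2N.
have [v alt11] := private_alternating d11 pr11.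
have duv : d u = d v by move: alt11; rewrite alternating_dual; apply: alternating_degree.
suff dux : d x1 = d u by split=> //; rewrite -dux; apply: card_class_of_switch alt11 _.
rewrite duv.
have [->|vx2] := eqVneq v x2; first by rewrite d11 d21.
have [->|vy2] := eqVneq v y2; first by [].
case/and3P: (pr11) => a11 na11 uy1; case/and3P: (pr22) => a22 na22 uy2.
case/andP: (alt11) => _ /and3P[avy avx vx1].
have [_ uv x1v yu1] := alternating_neq alt11.
have x1y1 : x1 != y1 by apply: contraTneq a11 => ->.
have x1y2 : x1 != y2 by apply: contraTneq a11 => ->.
have x2y1 : x2 != y1 by apply: contraTneq a22 => ->.
have x2u := adj_neq a22.
have e2 : adj S x2 u = adj S x2 v.
  by apply: (private_pair_third alt11); rewrite // ?d21 ?d11 // eq_sym.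
have e3 : adj S y2 u = adj S y2 v.
  by apply: (private_pair_third alt11); rewrite // -?d12 // eq_sym.
have [t alt22] := private_alternating d22 pr22.
have := private_unique alt22 (x' := v).
by rewrite /private -e2 -e3 a22 na22 vy2 => /(_ isT) vu; rewrite vu eqxx in uv.
Qed.

Definition degree_class u : {set V} := [set w | d w == d u].

Lemma card_nbrD S T u : #|nbr S u :\: nbr T u| = #|nbr T u :\: nbr S u|.
Proof.
have := cardsID (nbr T u) (nbr S u); have := cardsID (nbr S u) (nbr T u).
by rewrite !card_nbr setIC => <- /addnI.
Qed.

(** The five vertices found fill the degree class of u, which has at most five. *)
Lemma far_class S T u : 1 < #|nbr S u :\: nbr T u| ->
  exists x1 x2 y1 y2,
   [/\ [&& x1 != x2, y1 != y2, x1 != u, x2 != u, y1 != u & y2 != u],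
       [/\ x1 \in nbr S u :\: nbr T u & x2 \in nbr S u :\: nbr T u],
       [/\ y1 \in nbr T u :\: nbr S u & y2 \in nbr T u :\: nbr S u]
     & degree_class u = [set u; x1; x2; y1; y2]].
Proof.
move=> farST; have farTS := farST; rewrite card_nbrD in farTS.
case/card_gt1P: farST => x1 [x2 [x1N x2N x12]].
case/card_gt1P: farTS => y1 [y2 [y1N y2N y12]].
exists x1, x2, y1, y2.
have [dx1 le5] := far_degree x1N x2N x12 y1N y2N y12.
have [pr11 _ d11] := exchange_private x1N y1N.
have [pr22 _ d22] := exchange_private x2N y2N.
have [_ _ d12] := exchange_private x1N y2N.
move: (x1N) (x2N) (y1N) (y2N); rewrite !inE.
move=> /andP[nT1 S1] /andP[nT2 S2] /andP[nS1 T1] /andP[nS2 T2].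
have x1u := adj_neq S1; have x2u := adj_neq S2.
have y1u := adj_neq T1; have y2u := adj_neq T2.
split; first by rewrite x12 y12 !(eq_sym _ u) x1u x2u y1u y2u.
- by rewrite nT1 S1 nT2 S2.
- by rewrite nS1 T1 nS2 T2.
apply/esym/eqP; rewrite eqEcard; apply/andP; split.
  apply/subsetP=> w; rewrite !inE -!orbA => /or4P[||| /orP[]] /eqP-> //.
  - by rewrite dx1.
  - by rewrite d22 -d12 dx1.
  - by rewrite -d11 dx1.
  - by rewrite -d12 dx1.
apply: leq_trans le5 _.
have uS : uniq [:: u; x1; x2; y1; y2].
  have xy x y : adj S u x -> ~~ adj S u y -> x != y.
    by move=> ax; apply: contraNneq => <-.
  by rewrite /= !inE !negb_or x1u x2u y1u y2u x12 y12 !xy.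
rewrite -[5]/(size [:: u; x1; x2; y1; y2]) -(card_uniqP uS).
by apply: subset_leq_card; apply/subsetP=> w; rewrite !inE -!orbA.
Qed.

(** The neighbourhood of u in S determines the one in T: complementary inside the
    degree class, equal outside. *)
Lemma far_nbr S T u : 1 < #|nbr S u :\: nbr T u| ->
  nbr T u = (nbr S u :\: degree_class u) :|:
            (degree_class u :\ u :\: nbr S u).
Proof.
move=> /far_class[x1 [x2 [y1 [y2 [neq [x1N x2N] [y1N y2N] D]]]]].
have [_ _ d11] := exchange_private x1N y1N.
have inD w : (w \in degree_class u) = (d w == d u) by rewrite inE.
have dx1 : d x1 = d u by apply/eqP; rewrite -inD D !inE eqxx orbT.
have far w : w \in nbr S u :\: nbr T u -> w \in degree_class u.
  by move=> wN; have [_ _ ] := exchange_private wN y1N; rewrite inD -d11 dx1 => ->.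
have far' w : w \in nbr T u :\: nbr S u -> w \in degree_class u.
  by move=> wN; have [_ _ ] := exchange_private x1N wN; rewrite inD dx1 => ->.
apply/setP=> w; rewrite in_setU !in_setD in_set1.
have [wD|wD] /= := boolP (w \in degree_class u); last first.
  rewrite !andbF orbF; apply/idP/idP=> wN; apply: contraNT wD => wN'.
    by apply: far'; rewrite inE wN'.
  by apply: far; rewrite inE wN'.
rewrite andbT.
move: wD neq x1N x2N y1N y2N; rewrite D !inE -!orbA.
move=> wD /and5P[_ _ x1u x2u /andP[y1u y2u]] /andP[nT1 S1] /andP[nT2 S2].
move=> /andP[nS1 T1] /andP[nS2 T2].
case/or4P: wD => [||| /orP[]] /eqP->.
- by rewrite adj_irr eqxx andbF.
- by rewrite (negPf nT1) S1.
- by rewrite (negPf nT2) S2.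
- by rewrite T1 nS1 y1u.
- by rewrite T2 nS2 y2u.
Qed.

Definition agreeing (F : {set V}) (R : realization d) : {set realization d} :=
  [set S | [forall f in F, nbr S f == nbr R f]].

Lemma agreeingP F R S :
  reflect {in F, forall f, nbr S f = nbr R f} (S \in agreeing F R).
Proof.
rewrite inE; apply: (iffP forall_inP) => [H f /H/eqP //|H f /H->]; exact: eqxx.
Qed.

Lemma agreeing_adj F R S T f w : S \in agreeing F R -> T \in agreeing F R ->
  f \in F -> adj S f w = adj T f w.
Proof.
move=> /agreeingP SX /agreeingP TX fF.
by have := SX f fF; rewrite -(TX f fF) => /setP/(_ w); rewrite !inE.
Qed.

Lemma exchange_neighbour F R S u x y :
    S \in agreeing F R -> u \notin F -> x \notin F -> y \notin F ->
    private S x y u -> d x = d y ->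
    (forall v, alternating S x y u v -> v \notin F) ->
  exists S', [/\ S' \in agreeing F R, nbr S' u = y |: (nbr S u :\ x)
     & realization_adj d S S'].
Proof.
move=> SX uF xF yF pr dxy vF; have [v alt] := private_alternating dxy pr.
have vNF := vF v alt; exists (switch alt); split; last exact: realization_adj_switch.
  apply/agreeingP=> f fF; rewrite -(agreeingP _ _ _ SX) //; apply/setP=> w.
  rewrite !inE adj_switch four_cycleP !inE.
  have neq z : z \notin F -> (f == z) = false.
    by move=> zF; apply: contraNF zF => /eqP<-.
  by rewrite !neq // addbF.
have [xy uv xv yu] := alternating_neq alt.
case/andP: (alt) => /and3P[axu ayu _] /and3P[ayv axv _].
have xu := adj_neq axu.
apply/setP=> w; rewrite !inE adj_switch four_cycleP !inE eqxx.
rewrite !(eq_sym u) (negPf xu) (negPf yu) /=.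
have [->|wy] := eqVneq w y; first by rewrite adjC (negPf ayu) orbT.
have [->|wx] := eqVneq w x; first by rewrite adjC axu.
by rewrite addbF.
Qed.

Section Labels.
Variables (F : {set V}) (R : realization d) (u : V).
Hypothesis uF : u \notin F.
Let X := agreeing F R.
Let label S : {set V} := nbr S u.

(** Asking for both differences makes the relation symmetric on all sets. *)
Definition one_exchange (M N : {set V}) : bool :=
  (#|M :\: N| == 1) && (#|N :\: M| == 1).

Lemma one_exchange_sym : symmetric one_exchange.
Proof. by move=> M N; rewrite /one_exchange andbC. Qed.

Lemma changed_not_frozen S T x : S \in X -> T \in X ->
  adj S u x != adj T u x -> x \notin F.
Proof.
move=> SX TX; apply: contraNN => xF.
by rewrite !(adjC _ u) (agreeing_adj _ SX TX).
Qed.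

(** The exchange cannot move a frozen vertex. If the fourth vertex v of
    the switch were frozen, then in T, where x and y have already changed roles at u,
    both u and v would be private to y with respect to x. *)
Lemma label_step S N : S \in X -> N \in label @: X -> one_exchange (label S) N ->
  exists S', [/\ S' \in X, label S' = N & realization_adj d S S'].
Proof.
move=> SX /imsetP[T TX ->] /andP[/cards1P[x xE] /cards1P[y yE]].
have xN : x \in nbr S u :\: nbr T u by rewrite [_ :\: _]xE set11.
have yN : y \in nbr T u :\: nbr S u by rewrite [_ :\: _]yE set11.
have [prS prT dxy] := exchange_private xN yN.
have NE : label T = y |: (label S :\ x).
  rewrite /label -xE -yE; apply/setP=> w; rewrite !inE.
  by case: (adj S u w); case: (adj T u w).
move: xN yN; rewrite !inE => /andP[nTx Sx] /andP[nSy Ty].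
have xF : x \notin F by apply: (changed_not_frozen SX TX); rewrite Sx (negPf nTx).
have yF : y \notin F by apply: (changed_not_frozen SX TX); rewrite Ty (negPf nSy).
rewrite NE; apply: exchange_neighbour => // v alt; apply/negP=> vF.
have [_ uv _ _] := alternating_neq alt.
have [v' altT] := private_alternating (esym dxy) prT.
case/andP: (alt) => _ /and3P[ayv axv vx].
have := private_unique altT (x' := v).
rewrite /private vx !(adjC T _ v) -!(agreeing_adj _ SX TX vF) !(adjC S v) ayv axv.
by move=> /(_ isT) vu; rewrite vu eqxx in uv.
Qed.

Lemma labels_far M N : M \in label @: X -> N \in label @: X -> M != N ->
  ~~ one_exchange M N -> 1 < #|M :\: N|.
Proof.
move=> /imsetP[S SX ->] /imsetP[T TX ->] neq.
rewrite /one_exchange (card_nbrD T S) andbb.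
case E: #|_| => [|[|n]] // _; case/negP: neq; rewrite eqEcard !card_nbr leqnn andbT.
by rewrite -setD_eq0 -cards_eq0 E.
Qed.

Lemma labels_nearly_complete : nearly_complete one_exchange (label @: X).
Proof.
move=> M N N' ML NL N'L MN MN' far far'.
have := labels_far ML NL MN far; have := labels_far ML N'L MN' far'.
case/imsetP: ML NL N'L => S SX -> /imsetP[T TX ->] /imsetP[T' TX' ->].
by rewrite /label => /far_nbr-> /far_nbr->.
Qed.

(** No vertex of the degree class of u is frozen, so besides the label of S all
    four single exchanges of an xi for a yj occur. *)
Lemma far_labels_many S T : S \in X -> T \in X ->
  1 < #|label S :\: label T| -> 4 < #|label @: X|.
Proof.
move=> SX TX /far_class[x1 [x2 [y1 [y2 [neq [x1N x2N] [y1N y2N] D]]]]].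
have inD w : (w \in degree_class u) = (d w == d u) by rewrite inE.
have DF w : d w = d u -> w \notin F.
  move/eqP; rewrite -inD D !inE -!orbA.
  move: x1N x2N y1N y2N; rewrite !inE.
  move=> /andP[nT1 S1] /andP[nT2 S2] /andP[nS1 T1] /andP[nS2 T2].
  case/or4P=> [||| /orP[]] /eqP-> //; apply: (changed_not_frozen SX TX).
  - by rewrite (negPf nT1) S1.
  - by rewrite (negPf nT2) S2.
  - by rewrite (negPf nS1) T1.
  - by rewrite (negPf nS2) T2.
have exch x y : x \in nbr S u :\: nbr T u -> y \in nbr T u :\: nbr S u ->
    d x = d u -> y |: (nbr S u :\ x) \in label @: X.
  move=> xN yN dxu; have [pr _ dxy] := exchange_private xN yN.
  have [|||S' [S'X <- _]] := @exchange_neighbour F R S u x y SX uF _ _ pr dxy.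
  - exact: DF.
  - by apply: DF; rewrite -dxy.
  - move=> v alt; apply: DF; apply/esym.
    by rewrite alternating_dual in alt; apply: alternating_degree alt.
  - exact: imset_f.
have dx1 : d x1 = d u by apply/eqP; rewrite -inD D !inE eqxx orbT.
have dx2 : d x2 = d u by apply/eqP; rewrite -inD D !inE eqxx !orbT.
have sub : {subset [:: nbr S u; y1 |: (nbr S u :\ x1); y2 |: (nbr S u :\ x1);
                       y1 |: (nbr S u :\ x2); y2 |: (nbr S u :\ x2)]
              <= enum (label @: X)}.
  move=> N; rewrite mem_enum !inE => /or4P[||| /orP[]] /eqP->; try exact: exch.
  exact: imset_f.
rewrite cardE; apply: leq_trans (uniq_leq_size _ sub) => //.
apply: (@map_uniq _ _ (fun N : {set V} =>
  [:: x1 \in N; x2 \in N; y1 \in N; y2 \in N])).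
move: x1N x2N y1N y2N neq; rewrite !inE.
move=> /andP[nT1 S1] /andP[nT2 S2] /andP[nS1 T1] /andP[nS2 T2].
move=> /and3P[/negPf x12 /negPf y12 _].
have xy x y : adj S u x -> ~~ adj S u y -> (x == y) = false.
  by move=> ax; apply: contraNF => /eqP<-.
have x21 : (x2 == x1) = false by rewrite eq_sym.
have y21 : (y2 == y1) = false by rewrite eq_sym.
rewrite /= !in_setU1 !in_setD1 !inE !eqxx S1 S2 (negPf nS1) (negPf nS2).
by rewrite x12 y12 x21 y21 (xy x1 y1) // (xy x1 y2) // (xy x2 y1) // (xy x2 y2)
  // !andbF.
Qed.

Lemma labels_spanning_path :
  {in label @: X &, forall M N, M != N ->
     spanning_path one_exchange (label @: X) M N}.
Proof.
apply: nearly_complete_spanning_path; first exact: one_exchange_sym.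
  exact: labels_nearly_complete.
have [many|few] := leqP 5 #|label @: X|; first by right.
left=> M N ML NL MN; apply: contraT => far.
have := labels_far ML NL MN far.
case/imsetP: ML NL => S SX -> /imsetP[T TX ->] /(far_labels_many SX TX).
by rewrite leqNgt few.
Qed.

Lemma agreeing_cell S : S \in X ->
  cell label X (label S) = agreeing (u |: F) S.
Proof.
move=> SX; have /agreeingP SR := SX.
apply/setP=> T; apply/idP/agreeingP => [|TS].
  rewrite inE => /andP[/agreeingP TR /eqP TSu] f.
  by rewrite !inE => /predU1P[-> //|fF]; rewrite TR // SR.
rewrite inE [label T]TS ?setU11 // eqxx andbT; apply/agreeingP=> f fF.
by rewrite TS ?SR // inE fF orbT.
Qed.
End Labels.

(** Freezing the neighbourhood of one more vertex u turns each cell into a smaller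
    instance of the same statement. *)
Lemma agreeing_laceable (c : realization d -> bool) F R :
  proper_2coloring (realization_adj d) c ->
  point_or_laceable (realization_adj d) c (agreeing F R).
Proof.
move=> c_proper; have [n] := ubnP #|~: F|; elim: n F R => // n IHn F R.
rewrite ltnS => leFn; have [FT|] := boolP (~: F == set0).
  left; exists R; apply/setP=> S; rewrite inE; apply/agreeingP/eqP=> [SR|-> //].
  apply: realization_eq => p q; have pF : p \in F.
    by have /setP/(_ p) := eqP FT; rewrite !inE => /negbFE.
  by have /setP/(_ q) := SR p pF; rewrite !inE.
case/set0Pn=> u; rewrite inE => uF.
apply: (glue_cells (g := fun S : realization d => nbr S u)
  (@realization_adj_sym _ _) c_proper one_exchange_sym).
- by move=> S N SX NL SN; apply: label_step SN.
- exact: labels_spanning_path.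
- move=> S SX; rewrite agreeing_cell //; apply: IHn.
  apply: leq_trans leFn; apply: proper_card; apply/properP; split.
    by rewrite setCS subsetU1.
  by exists u; rewrite !inE ?uF // eqxx.
- by apply/set0Pn; exists R; apply/agreeingP.
Qed.
(** * The colouring *)

(** Only the adjacencies of a and b to x and y change, and by uniqueness of private
    neighbours these are the only vertices that tell a and b apart. *)
Lemma adj_switch_tperm S a b x y (alt : alternating S a b x y) p q :
  adj (switch alt) p q = adj S (tperm a b p) (tperm a b q).
Proof.
have [ab xy ay bx] := alternating_neq alt.
case/andP: (alt) => /and3P[aax nabx _] /and3P[aby naay _].
have ax := adj_neq aax; have by_ := adj_neq aby.
have same t : t != a -> t != b -> t != x -> t != y -> adj S a t = adj S b t.
  move=> ta tb tx ty; apply/idP/idP => at_; apply: contraT => nat_.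
    have := private_unique alt (x' := t); rewrite /private at_ nat_ tb => /(_ isT).
    by move/eqP; rewrite (negPf tx).
  have := @private_unique S b a y x t; rewrite alternatingC => /(_ alt).
  by rewrite /private at_ nat_ ta => /(_ isT)/eqP; rewrite (negPf ty).
have move_a t : t != a -> t != b ->
    adj S a t (+) (t \in pred2 x y) = adj S b t.
  move=> ta tb; rewrite !inE.
  have [->|tx] := eqVneq t x; first by rewrite aax (negPf nabx).
  have [->|ty] := eqVneq t y; first by rewrite aby (negPf naay).
  by rewrite addbF same.
have move_b t : t != a -> t != b ->
    adj S b t (+) (t \in pred2 x y) = adj S a t.
  by move=> ta tb; rewrite -move_a // addbK.
have xN : (a \in pred2 x y) = false by rewrite !inE (negPf ax) (negPf ay).
have yN : (b \in pred2 x y) = false by rewrite !inE (negPf bx) (negPf by_).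
have aP : a \in pred2 a b by rewrite !inE eqxx.
have bP : b \in pred2 a b by rewrite !inE eqxx orbT.
have nP t : t != a -> t != b -> (t \in pred2 a b) = false.
  by move=> /negPf ta /negPf tb; rewrite !inE ta tb.
rewrite adj_switch four_cycleP.
case: tpermP => [->|->|/eqP pa /eqP pb]; case: tpermP => [->|->|/eqP qa /eqP qb];
  rewrite ?xN ?yN ?aP ?bP ?(nP p) ?(nP q) ?andbF ?andbT ?orbF ?addbF ?adj_irr //=.
- exact: adjC.
- exact: move_a.
- exact: adjC.
- exact: move_b.
- by rewrite !(adjC S p) move_a.
- by rewrite !(adjC S p) move_b.
Qed.

Definition ranks_below (p q : V) : bool := enum_rank p < enum_rank q.

Lemma ranks_belowC p q : p != q -> ranks_below q p = ~~ ranks_below p q.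
Proof.
by move=> pq; rewrite /ranks_below -leqNgt [RHS]leq_eqVlt val_eqE
  (inj_eq enum_rank_inj) eq_sym (negPf pq).
Qed.

Definition flip (p : V * V) : V * V := (p.2, p.1).

Lemma flipK : involutive flip. Proof. by case. Qed.

(** A sum over unordered pairs, written with either of two choices i, j of
    representatives. *)
Lemma orientation_change (B i j h : pred (V * V)) :
    (forall p, B (flip p) = B p) ->
    (forall p, B p -> i (flip p) = ~~ i p) ->
    (forall p, B p -> j (flip p) = ~~ j p) ->
  \big[addb/false]_(p | B p && j p) h p =
  \big[addb/false]_(p | B p && i p) (if j p then h p else h (flip p)).
Proof.
move=> Bflip iflip jflip; rewrite (bigID i) [RHS](bigID j) /=; congr (_ (+) _).
  by apply: eq_big => [p|p /andP[/andP[_ ->]]] //; rewrite andbAC.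
rewrite (reindex_inj (inv_inj flipK)); apply: eq_big => [p|p].
  case Bp: (B p); rewrite Bflip Bp //= iflip // jflip //.
  by rewrite negbK andbC.
by rewrite Bflip => /andP[/andP[Bp jp] _]; rewrite jflip // in jp; rewrite (negPf jp).
Qed.

Definition private_neighbour S u v : V := odflt u [pick x | private S u v x].

Lemma active_alternating S u v : active S u v ->
  alternating S u v (private_neighbour S u v) (private_neighbour S v u).
Proof.
case/activeP=> x [y alt]; case/andP: (alt) => prx pry.
have pnE p q z t : alternating S p q z t -> private S p q (private_neighbour S p q).
  move=> /andP[pz _]; rewrite /private_neighbour.
  by case: pickP => //= /(_ z); rewrite pz.
apply/andP; split; first exact: pnE alt.
by rewrite alternatingC in alt; apply: pnE alt.
Qed.

Lemma private_neighbourE S u v x y : alternating S u v x y ->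
  private_neighbour S u v = x.
Proof.
move=> alt; apply: (private_unique alt).
by have /active_alternating/andP[] : active S u v by apply/activeP; exists x, y.
Qed.

Definition active_pair S (p : V * V) : bool := active S p.1 p.2.
Definition adj_pair S (p : V * V) : bool := adj S p.1 p.2.
Definition below (p : V * V) : bool := ranks_below p.1 p.2.
Definition opposite S (p : V * V) : V * V :=
  (private_neighbour S p.1 p.2, private_neighbour S p.2 p.1).

(** The sum runs over one representative of each active pair that is an edge;
    [addb] makes it a parity. Restricting it to edges selects exactly one pair from
    each {p, opposite p}, which is what makes the parity change under a switch. *)
Definition colour S : bool :=
  \big[addb/false]_(p | active_pair S p && adj_pair S p && below p)
     below (opposite S p).

Lemma opposite_alternating S p : active_pair S p ->
  alternating S p.1 p.2 (opposite S p).1 (opposite S p).2.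
Proof. exact: active_alternating. Qed.

Lemma active_opposite S p : active_pair S p -> active_pair S (opposite S p).
Proof.
move=> /opposite_alternating; rewrite alternating_dual => alt.
by apply/activeP; exists p.1, p.2.
Qed.

Lemma oppositeK S p : active_pair S p -> opposite S (opposite S p) = p.
Proof.
move=> /opposite_alternating; rewrite alternating_dual => alt.
rewrite [LHS]/opposite (private_neighbourE alt).
rewrite alternatingC in alt; rewrite (private_neighbourE alt).
by case: p {alt}.
Qed.

(** This is the induced path: exactly one of the two diagonals is an edge. *)
Lemma adj_opposite S p : active_pair S p ->
  adj_pair S (opposite S p) = ~~ adj_pair S p.
Proof.
move=> /opposite_alternating/alternating_P4; rewrite /adj_pair.
by case: (adj S p.1 p.2); case: (adj S _ _).
Qed.

Lemma opposite_flip S p : opposite S (flip p) = flip (opposite S p).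
Proof. by []. Qed.

Lemma active_pair_flip S p : active_pair S (flip p) = active_pair S p.
Proof. exact: activeC. Qed.

Lemma active_pair_neq S p : active_pair S p -> p.1 != p.2.
Proof. by move=> /opposite_alternating/alternating_neq[]. Qed.

Section SwitchParity.
Variables (S : realization d) (a b x y : V).
Hypothesis alt : alternating S a b x y.
Let tau := tperm a b.
Let tau2 (p : V * V) : V * V := (tau p.1, tau p.2).

Lemma tau2K : involutive tau2.
Proof. by case=> p q; rewrite /tau2 /= !tpermK. Qed.

Lemma alternating_switch u v z t :
  alternating (switch alt) u v z t = alternating S (tau u) (tau v) (tau z) (tau t).
Proof.
by rewrite /alternating /private !adj_switch_tperm !(inj_eq perm_inj).
Qed.

Lemma active_switch p : active_pair (switch alt) p = active_pair S (tau2 p).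
Proof.
apply/activeP/activeP=> [] [z [t zt]]; exists (tau z), (tau t).
  by rewrite -alternating_switch.
by rewrite alternating_switch !tpermK.
Qed.

Lemma opposite_switch p : active_pair (switch alt) p ->
  opposite (switch alt) p = tau2 (opposite S (tau2 p)).
Proof.
rewrite active_switch => act.
have := opposite_alternating act.
set z := (opposite S (tau2 p)).1; set t := (opposite S (tau2 p)).2.
rewrite -[z](tpermK a b) -[t](tpermK a b) -alternating_switch => alt'.
rewrite {1}/opposite (private_neighbourE alt').
by rewrite alternatingC in alt'; rewrite (private_neighbourE alt').
Qed.

(* inverted marks the pairs whose order is reversed by the transposition *)
Let below_tau p := below (tau2 p).
Let inverted p := below p (+) below_tau p.

Lemma below_flip p : p.1 != p.2 -> below (flip p) = ~~ below p.
Proof. exact: ranks_belowC. Qed.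

Lemma below_tau_flip p : p.1 != p.2 -> below_tau (flip p) = ~~ below_tau p.
Proof. by move=> pq; apply: ranks_belowC; rewrite (inj_eq perm_inj). Qed.

Lemma inverted_flip p : p.1 != p.2 -> inverted (flip p) = inverted p.
Proof.
move=> pq; rewrite /inverted below_flip // below_tau_flip //.
by rewrite addbN addNb negbK.
Qed.

(** Transport of the sum along tau, rewritten over the same representatives as
    the colour of S. *)
Lemma colour_switchE : colour (switch alt) =
  \big[addb/false]_(p | active_pair S p && adj_pair S p && below p)
    (below_tau (opposite S p) (+) inverted p).
Proof.
pose B p := active_pair S p && adj_pair S p.
transitivity (\big[addb/false]_(p | B p && below_tau p) below_tau (opposite S p)).
  rewrite /colour (reindex_inj (inv_inj tau2K)); apply: eq_big => p.
    rewrite active_switch tau2K; congr (_ && _ && _).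
    by rewrite /adj_pair adj_switch_tperm /= !tpermK.
  by case/andP=> /andP[act _] _; rewrite opposite_switch // tau2K.
have Bneq p : B p -> p.1 != p.2 by case/andP=> /active_pair_neq.
rewrite (orientation_change (i := below)).
- apply: eq_bigr => p /andP[Bp ip]; rewrite /inverted ip.
  rewrite opposite_flip below_tau_flip; last first.
    by apply: (@active_pair_neq S); case/andP: Bp => /active_opposite.
  by case: (below_tau p); case: (below_tau _).
- by move=> p; rewrite /B active_pair_flip /adj_pair adjC.
- by move=> p /Bneq/below_flip.
- by move=> p /Bneq/below_tau_flip.
Qed.

(** The transposition (a b) reverses the pair {a, b}; any other reversed pair is
    {a, q} or {b, q}, and for each q both of these are active or neither is, and both
    are reversed or neither is. The representatives are chosen with a first and b
    second, so that these pairs are listed as (a, q) and (b, q). *)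
Lemma sum_inverted :
  \big[addb/false]_(p | active_pair S p && below p) inverted p = true.
Proof.
pose ahead (p : V * V) := (p.1 == a) || (p.2 != a) &&
  ((p.1 == b) || (p.2 != b) && below p).
have [ab _ _ _] := alternating_neq alt.
have actab : active S a b by apply/activeP; exists x, y.
have aheadC p : p.1 != p.2 -> ahead (flip p) = ~~ ahead p.
  case: p => p q /= pq; rewrite /ahead /=.
  have [qa|qa] := eqVneq q a; first by rewrite -qa (negPf pq).
  have [pa|pa] := eqVneq p a; first by [].
  have [qb|qb] := eqVneq q b; first by rewrite -qb (negPf pq).
  have [pb|pb] := eqVneq p b; first by [].
  exact: (@below_flip (p, q)).
have neq p : active_pair S p -> p.1 != p.2 by apply: active_pair_neq.
transitivity (\big[addb/false]_(p | active_pair S p && ahead p) inverted p).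
  rewrite (orientation_change (i := ahead)).
  - apply: eq_bigr => p /andP[/neq pq _].
    by rewrite inverted_flip // if_same.
  - exact: active_pair_flip.
  - by move=> p /neq/aheadC.
  - by move=> p /neq/below_flip.
rewrite -(pair_big_dep xpredT (fun p q => active S p q && ahead (p, q))
            (fun p q => inverted (p, q))) /=.
rewrite (bigD1 a) //= [X in _ (+) X](bigD1 b) 1?eq_sym //=.
rewrite [X in _ (+) (_ (+) X)]big1; last first.
  move=> p /andP[pa pb]; rewrite big1 // => q /andP[_].
  rewrite /ahead /= (negPf pa) (negPf pb) /= => /and3P[qa qb _].
  rewrite /inverted /below_tau /tau2 /below /= !tpermD 1?eq_sym //.
  exact: addbb.
rewrite addbF (bigD1 b) /=; last by rewrite actab /ahead eqxx.
rewrite -addbA [X in _ (+) (X (+) _)](_ : _ =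
  \big[addb/false]_(q | active S b q && ahead (b, q)) inverted (b, q)).
  rewrite addbb addbF /inverted /below_tau /tau2 /= tpermL tpermR.
  by rewrite /below /= (ranks_belowC ab) addbN addbb.
apply: eq_big => q.
  rewrite /ahead /= !eqxx /= [b == a]eq_sym (negPf ab) /= !andbT.
  have nact p : active S p p = false.
    by case act: (active S p p) => //; have := neq (p, p) act; rewrite eqxx.
  have [->|qa] := eqVneq q a; first by rewrite nact andbF.
  have [->|qb] := eqVneq q b; first by rewrite nact andbF.
  rewrite !andbT.
  apply/idP/idP=> act.
    apply: (@active_class S b q a) => //; first by rewrite activeC.
    have dab := alternating_degree alt; rewrite -dab; apply/esym.
    by case/activeP: act => z [t /alternating_degree].
  apply: (@active_class S a q b) => //.
  have dab := alternating_degree alt; rewrite dab; apply/esym.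
  by case/activeP: act => z [t /alternating_degree].
move=> /andP[/andP[act _] qb].
have qa : q != a by rewrite eq_sym; apply: (neq (a, q)).
rewrite /inverted /below_tau /tau2 /= tpermL tpermR !tpermD 1?eq_sym //.
by rewrite addbC.
Qed.

(** The two colours differ by the inversions of the active edges and of their
    opposite pairs, that is, of all active pairs. *)
Lemma colour_switch : colour (switch alt) = ~~ colour S.
Proof.
rewrite colour_switchE -[RHS]addTb; apply: (can_inj (addbK (colour S))).
rewrite addbK /colour -big_split /=.
rewrite (eq_bigr (fun p => inverted (opposite S p) (+) inverted p)); last first.
  move=> p _; rewrite [inverted (opposite S p)]/inverted.
  by rewrite addbAC [below _ (+) _]addbC.
rewrite big_split /= -[RHS]sum_inverted [RHS](bigID (adj_pair S)) /= addbC.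
congr (_ (+) _).
  by apply: eq_bigl => p; rewrite andbAC.
pose B p := active_pair S p && ~~ adj_pair S p.
transitivity (\big[addb/false]_(p | B p && below (opposite S p)) inverted p).
  rewrite [RHS](reindex_onto (opposite S) (opposite S)) /=; last first.
    by move=> p /andP[/andP[/oppositeK]].
  apply: eq_bigl => p; rewrite /B; have [act|nact] := boolP (active_pair S p).
    by rewrite active_opposite // adj_opposite // oppositeK // eqxx negbK andbT.
  apply/esym/negP=> /andP[/andP[/andP[act _] _] /eqP pE]; case/negP: nact.
  by rewrite -pE active_opposite.
have Bneq p : B p -> p.1 != p.2 by case/andP=> /active_pair_neq.
rewrite (orientation_change (i := below)).
- apply: eq_big => [p|p /andP[/Bneq pq _]]; first by rewrite /B andbAC.
  by rewrite inverted_flip // if_same.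
- by move=> p; rewrite /B active_pair_flip /adj_pair adjC.
- by move=> p /Bneq/below_flip.
- move=> p Bp; rewrite opposite_flip below_flip //.
  by apply: (@active_pair_neq S); case/andP: Bp => /active_opposite.
Qed.
End SwitchParity.

Lemma colour_proper : proper_2coloring (realization_adj d) colour.
Proof.
move=> S T /adjacent_alternating[u [v [x [y [alt TE]]]]].
have -> : T = switch alt by apply: val_inj.
by rewrite colour_switch; case: (colour S).
Qed.
End TriangleFree.

(** * Maximal Hamiltonicity *)

Theorem theorem3p1 (V : finType) (d : V -> 'I_#|V|) :
  graphical d ->
  triangle_free (realization_adj d) ->
  maximally_hamiltonian (realization_adj d).
Proof.
move=> [E realE] tf; pose R : realization d := exist _ E realE.
have allR : agreeing set0 R = [set: realization d].
  by apply/setP=> S; rewrite !inE; apply/forall_inP=> f; rewrite inE.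
have := agreeing_laceable tf set0 R (colour_proper tf).
rewrite allR => -[[S allS]|[[S [T [_ _ cST]]] lac]].
  apply: Or31; left; split; first by rewrite -cardsT allS cards1.
  move=> x y /negP[]; apply/eqP.
  have := in_setT x; have := in_setT y; rewrite allS !inE.
  by move=> /eqP-> /eqP->.
apply: Or32; exists (@colour V d); split; first exact: colour_proper.
  by case cS: (colour S) cST; case cT: (colour T) => // _; split;
    [exists S|exists T; rewrite cT|exists T|exists S; rewrite cS].
move=> S' T' cST'; apply: spanning_path_setT.
by apply: lac; rewrite ?inE.
Qed.
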